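(* Let $\mathcal X,\mathcal Y$ be Polish spaces, let $\mathbf x_1,\dots,\mathbf x_m\in\mathcal X$ be pairwise distinct, and let $P=\sum_{k=1}^m p_k\delta_{\mathbf x_k}$ with $p_k>0$ for all $k$ and $\sum_{k=1}^m p_k=1$. Let $Q$ be a Borel probability measure on $\mathcal Y$ and let $c:\mathcal X\times\mathcal Y\to[0,\infty)$ be a continuous cost for which there exist continuous functions $a\in L^1(P)$ and $b\in L^1(Q)$ with $c(\mathbf x,\mathbf y)\ge a(\mathbf x)+b(\mathbf y)$ for all $(\mathbf x,\mathbf y)\in\operatorname{supp}(P)\times\operatorname{supp}(Q)$. Assume that $$\int c(\mathbf x_i,\mathbf y)\,dQ(\mathbf y)<\infty\quad\text{for all } i=1,\dots,m.$$ Let $P_n$ be the empirical measure of an i.i.d. sample of size $n$ with law $P$. Then, as $n\to\infty$, $$\sqrt n\,\bigl(\mathcal T_c(P_n,Q)-\mathcal T_c(P,Q)\bigr)\ \overset{w}{\longrightarrow}\ \sup_{\mathbf z\in\operatorname{Opt}_c(P,Q)}\ \sum_{i=1}^m z_iX_i,$$ where $(X_1,\dots,X_m)\sim\mathcal N(\mathbf 0,\Sigma(\mathbf p))$.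
   Context: $\overset{w}{\longrightarrow}$ denotes weak convergence (convergence in distribution). The optimal transport cost is $\mathcal T_c(P,Q)=\inf_{\pi\in\Pi(P,Q)}\int_{\mathcal X\times\mathcal Y}c(\mathbf x,\mathbf y)\,d\pi(\mathbf x,\mathbf y)$, where $\Pi(P,Q)$ is the set of Borel probability measures on $\mathcal X\times\mathcal Y$ with marginals $P$ and $Q$. If $X^{(1)},\dots,X^{(n)}$ are i.i.d. with law $P$, then $P_n=\frac1n\sum_{k=1}^n\delta_{X^{(k)}}$. Write $\mathbf p=(p_1,\dots,p_m)$. For $\mathbf z\in\mathbb R^m$ and $\mathbf p\in\mathbb R^m\setminus\{\mathbf 0\}$, $$\mathcal M(\mathbf z,\mathbf p)=\frac1{\|\mathbf p\|_1}\sum_{k=1}^m|p_k|z_k+\int\min_{i=1,\dots,m}\{c(\mathbf x_i,\mathbf y)-z_i\}\,dQ(\mathbf y),\qquad \|\mathbf p\|_1=\sum_{k=1}^m|p_k|.$$ The set of optimal values is $\operatorname{Opt}_c(P,Q)=\{\mathbf z\in\mathbb R^m:\ \mathcal T_c(P,Q)=\mathcal M(\mathbf z,\mathbf p)\}$. $\Sigma(\mathbf p)$ is the $m\times m$ matrix with entries $\Sigma(\mathbf p)_{ii}=p_i(1-p_i)$ and $\Sigma(\mathbf p)_{ij}=-p_ip_j$ for $i\ne j$. *)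

(* Defs.v *)
From HB Require Import structures.
From mathcomp Require Import all_boot all_order all_algebra.
From mathcomp Require Import finmap.
From mathcomp Require Import all_classical all_reals all_analysis.

Set Implicit Arguments.
Unset Strict Implicit.
Unset Printing Implicit Defensive.

Import Order.TTheory GRing.Theory Num.Theory.
Import numFieldNormedType.Exports.

Local Open Scope classical_set_scope.
Local Open Scope ring_scope.

Definition polish (R : realType) (T : topologicalType) : Prop :=
  (exists dist : T -> T -> R,
    [/\ (forall x y, dist x y = 0 <-> x = y),
        (forall x y, dist x y = dist y x),
        (forall x y z, dist x z <= dist x y + dist y z),
        (forall (x : T) (A : set T), nbhs x A <->
          exists2 e, 0 < e & [set y | dist x y < e] `<=` A) &
        (forall u : nat -> T,
          (forall e, 0 < e -> exists N, forall i j,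
            (N <= i)%N -> (N <= j)%N -> dist (u i) (u j) < e) ->
          exists l : T, u @ \oo --> l)]) /\
  (exists2 D : set T, countable D & dense D).

HB.instance Definition _ (X Y : ptopologicalType) := Pointed.on (X * Y)%type.

Definition borel (T : ptopologicalType) := g_sigma_algebraType (@open T).

(* supp mu: the points all of whose open neighbourhoods are charged by mu. *)
Definition supp (R : realType) (T : ptopologicalType)
    (mu : {measure set (borel T) -> \bar R}) : set T :=
  [set x | forall U : set T, open U -> U x -> (0 < mu U)%E].

Section transport.
Context {R : realType} {X Y : ptopologicalType}.

(* borel (X * Y) is generated by the open sets of the product topology. *)
Definition couplings (mu : {measure set (borel X) -> \bar R})
    (nu : {measure set (borel Y) -> \bar R}) :
    set (probability (borel (X * Y)%type) R) :=
  [set pi | (forall A : set (borel X), measurable A -> pi (A `*` setT) = mu A) /\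
            (forall B : set (borel Y), measurable B -> pi (setT `*` B) = nu B)].

Definition transport_cost (c : X * Y -> R)
    (mu : {measure set (borel X) -> \bar R})
    (nu : {measure set (borel Y) -> \bar R}) : \bar R :=
  ereal_inf [set \int[pi]_xy (c xy)%:E | pi in couplings mu nu]%E.

(* With identity +oo, the iterated mine is the minimum over the m points (and
   +oo for m = 0, excluded by a weight vector of sum 1). *)
Definition dual_obj (m : nat) (c : X * Y -> R) (x : 'I_m -> X)
    (Q : {measure set (borel Y) -> \bar R}) (z p : 'rV[R]_m) : \bar R :=
  (((\sum_k `|p 0 k|)^-1 * \sum_k `|p 0 k| * z 0 k)%:E +
   \int[Q]_y \big[mine/+oo]_(i < m) (c (x i, y) - z 0 i)%:E)%E.

Definition Opt (m : nat) (c : X * Y -> R) (x : 'I_m -> X) (p : 'rV[R]_m)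
    (P : {measure set (borel X) -> \bar R})
    (Q : {measure set (borel Y) -> \bar R}) : set 'rV[R]_m :=
  [set z | transport_cost c P Q = dual_obj c x Q z p].

End transport.

Section sampling.
Context {R : realType} {d : measure_display} {W : measurableType d}.

Definition mutually_independent (d' : measure_display) (T : measurableType d')
    (Pr : probability W R) (xi : nat -> {RV Pr >-> T}) : Prop :=
  forall (J : {fset nat}) (A : nat -> set T), (forall k, measurable (A k)) ->
    Pr (\bigcap_(k in [set` J]) (xi k @^-1` A k)) =
    (\prod_(k <- J) Pr (xi k @^-1` A k))%E.

Definition iid_sample (T : ptopologicalType) (Pr : probability W R)
    (P : probability (borel T) R) (xi : nat -> {RV Pr >-> borel T}) : Prop :=
  mutually_independent xi /\
  forall k (A : set (borel T)), measurable A -> distribution Pr (xi k) A = P A.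

Definition empirical (T : ptopologicalType) (xi : nat -> W -> borel T)
    (n : nat) (w : W) : {measure set (borel T) -> \bar R} :=
  mscale (n%:R^-1)%:nng (msum (fun k => \d_(xi k w)) n).

(* Unlike normal_prob at s = 0, the variance 0 is the Dirac mass. *)
Definition normal_law (mean var : R) (A : set R) : \bar R :=
  if var == 0 then \d_mean A else normal_prob mean (Num.sqrt var) A.

(* G ~ N(mu, S), S possibly singular: every linear combination of the
   coordinates of G is a (possibly degenerate) real normal variable. *)
Definition gaussian_vector (m : nat) (Pr : probability W R)
    (mu : 'rV[R]_m) (S : 'M[R]_m) (G : 'I_m -> {RV Pr >-> R}) : Prop :=
  forall (t : 'rV[R]_m) (A : set R), measurable A ->
    Pr [set w | A (\sum_i t 0 i * G i w)] =
    normal_law ((t *m mu^T) 0 0) ((t *m S *m t^T) 0 0) A.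

End sampling.

Definition Sigma (R : realType) (m : nat) (p : 'rV[R]_m) : 'M[R]_m :=
  \matrix_(i, j) (if i == j then p 0 i * (1 - p 0 i) else - (p 0 i * p 0 j)).

(* Convergence in distribution, in R, of maps Z n, Z' that are only almost
   surely real-valued, through real random variables that are versions of
   them: a transport cost may be infinite on a null event, and so is the
   supremum of a Gaussian linear form over a set that contains a line. *)
Definition cvg_in_distribution (R : realType) (d d' : measure_display)
    (W : measurableType d) (W' : measurableType d')
    (Pr : probability W R) (Pr' : probability W' R)
    (Z : nat -> W -> \bar R) (Z' : W' -> \bar R) : Prop :=
  exists (V : nat -> {RV Pr >-> R}) (V' : {RV Pr' >-> R}),
    [/\ (\forall n \near \oo, {ae Pr, forall w, Z n w = (V n w)%:E}),
        {ae Pr', forall w, Z' w = (V' w)%:E} &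
        forall f : R -> R, continuous f ->
          (exists M, forall r, `|f r| <= M) ->
          ('E_Pr[f \o V n] @[n --> \oo] --> 'E_Pr'[f \o V'])%E].

(* Main.v *)
(* Let phi(q) be the transport cost between sum_i q_i delta_(x_i) and Q. It is
   convex and bounded on the simplex, and its convex conjugate is explicit: the
   supremum over q is attained by sending each y to a minimiser of
   c(x_i, y) - z_i. Hence no general duality theorem is needed, and Opt is
   exactly the set of subgradients of phi at p. As p is interior to the simplex,
   a finite-dimensional Hahn-Banach argument identifies the directional
   derivative of phi at p in a direction h of total mass 0 with the supremum of
   z . h over Opt, and convexity makes the difference quotients converge
   uniformly on compact sets. What remains is the central limit theorem for
   multinomial counts against continuous functions. It is proved for cos(th +
   t . x) by a telescoping estimate, and transferred through trigonometric sums
   that approximate a continuous function on a box without exceeding its bound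
   elsewhere: Bernstein polynomials in the variables sin(x_i / L). *)

From HB Require Import structures.
Require Import Defs.
From mathcomp Require Import all_boot all_order all_algebra.
From mathcomp Require Import finmap.
From mathcomp Require Import all_classical all_reals all_analysis.
From mathcomp Require Import measurable_realfun ring lra.

Set Implicit Arguments.
Unset Strict Implicit.
Unset Printing Implicit Defensive.

Import Order.TTheory GRing.Theory Num.Theory.
Import numFieldNormedType.Exports.

Local Open Scope classical_set_scope.
Local Open Scope ring_scope.

(** * Independent draws from a finite set *)

Section elementary_bounds.
Context {R : realType}.
Implicit Types x y : R.

(** The limit is handled as the value of one finite continuous functional [D] on row vectors, not as
    a supremum. Adding a constant vector to [z] preserves [Opt], so the supremum over [Opt] is
    finite only in directions of total mass 0. The Gaussian vector has total 0 almost surely,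
    because the all-ones form has variance 0, and there the supremum is attained and equals [D]. The
    sample enters only through its counts, up to a null event where a draw misses the atoms, so
    expectations over it become the finite sums [iidE]. The Gaussian law is given only through its
    linear forms, hence the cosines of linear forms as test functions. Sums of these do not in
    general approximate a bounded continuous function uniformly on the whole space. Outside a large
    box only a common bound remains, and it is paid for by the second moments of the normalised
    counts, at most 1 for every n. A bound growing with the accuracy of the approximation would ruin
    this tail estimate, which is why the approximants must keep the bound of the function. *)

Lemma MVT0 (f df : R -> R) x : (forall y, is_derive y 1 f (df y)) -> 0 <= x ->
  exists2 y, 0 <= y <= x & f x = f 0 + df y * x.
Proof.
move=> fdf x0.
have fc : {within `[0, x], continuous f}.
  apply: continuous_subspaceT => y.
  exact/differentiable_continuous/derivable1_diffP/ex_derive.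
have [y yx fE] := MVT_segment x0 (fun y _ => fdf y) fc.
by exists y; [rewrite in_itv in yx|rewrite -[x in df y * x]subr0 -fE subrKC].
Qed.

Lemma cos_ge1Bsqr x : 1 - x ^+ 2 / 2 <= cos x.
Proof.
wlog x0 : x / 0 <= x.
  move=> H; have [/H//|/ltW x0] := leP 0 x.
  by rewrite -cosN -sqrrN; apply: H; rewrite oppr_ge0.
have df (y : R) : is_derive y 1 (fun z => cos z + z ^+ 2 / 2) (- sin y + y).
  by apply: is_derive_eq; rewrite /GRing.scale/=; field.
have dg (y : R) : is_derive y 1 (fun z => z - sin z) (1 - cos y).
  by apply: is_derive_eq; rewrite /GRing.scale/=; field.
have [y /andP[y0 _]] := MVT0 df x0.
have [z _] := MVT0 dg y0.
rewrite cos0 sin0 expr0n/= mul0r addr0 subr0 add0r => gE fE.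
have : 0 <= (- sin y + y) * x.
  by rewrite addrC gE !mulr_ge0// subr_ge0 cos_le1.
move: fE => /=; lra.
Qed.

(** By the mean value theorem [x - sin x] is [(1 - cos z) * x] with [z <= x], and the quadratic
    bound on the cosine applies. Here and below the constant 1 stands for the sharp Taylor
    constants, since only the order matters. *)
Lemma sin_cubic_ge0 x : 0 <= x -> 0 <= x - sin x <= x ^+ 3.
Proof.
move=> x0.
have dg (y : R) : is_derive y 1 (fun z => z - sin z) (1 - cos y).
  by apply: is_derive_eq; rewrite /GRing.scale/=; field.
have [z /andP[z0 zx]] := MVT0 dg x0.
rewrite sin0 subrr add0r => ->.
rewrite mulr_ge0 ?subr_ge0 ?cos_le1//= exprSr ler_wpM2r//.
have := cos_ge1Bsqr z; have : z ^+ 2 <= x ^+ 2 by rewrite lerXn2r// nnegrE.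
have := sqr_ge0 z; lra.
Qed.

Lemma sin_cubic x : `|sin x - x| <= `|x| ^+ 3.
Proof.
wlog x0 : x / 0 <= x.
  move=> H; have [/H//|/ltW x0] := leP 0 x.
  have := H (- x); rewrite sinN normrN -opprD normrN; apply.
  by rewrite oppr_ge0.
have /andP[H1 H2] := sin_cubic_ge0 x0.
by rewrite distrC !ger0_norm.
Qed.

Lemma cos_quartic x : `|cos x - 1 + x ^+ 2 / 2| <= `|x| ^+ 4.
Proof.
wlog x0 : x / 0 <= x.
  move=> H; have [/H//|/ltW x0] := leP 0 x.
  have := H (- x); rewrite cosN normrN sqrrN; apply.
  by rewrite oppr_ge0.
have df (y : R) :
    is_derive y 1 (fun z => cos z - 1 + z ^+ 2 / 2) (- sin y + y).
  by apply: is_derive_eq; rewrite /GRing.scale/=; field.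
have [y /andP[y0 yx]] := MVT0 df x0.
rewrite cos0 expr0n/= mul0r addr0 subrr add0r => ->.
have /andP[H1 H2] := sin_cubic_ge0 y0.
rewrite addrC normrM !ger0_norm// (exprSr x) ler_wpM2r//.
by rewrite (le_trans H2)// lerXn2r// nnegrE.
Qed.

Lemma expRN_quadratic x : 0 <= x -> `|expR (- x) - 1 + x| <= x ^+ 2.
Proof.
move=> x0.
have df (y : R) : is_derive y 1 (fun z => expR (- z) - 1 + z) (1 - expR (- y)).
  by apply: is_derive_eq; rewrite /GRing.scale/=; field.
have [y /andP[y0 yx]] := MVT0 df x0.
rewrite oppr0 expR0 subrr addr0 add0r => ->.
have e1 : expR (- y) <= 1 by rewrite expR_le1 oppr_le0.
rewrite normrM !ger0_norm ?subr_ge0// expr2 ler_wpM2r//.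
have := expR_ge1Dx (- y); lra.
Qed.

Lemma cvg_sqrtnV0 : (Num.sqrt n%:R)^-1 @[n --> \oo] --> (0 : R).
Proof.
apply/cvgrPdist_le => e e0; near=> n.
have n0 : (0 : R) < n%:R.
  by rewrite ltr0n; near: n; exact: nbhs_infty_gt.
rewrite sub0r normrN ger0_norm ?invr_ge0 ?sqrtr_ge0//.
rewrite -[leRHS]invrK lef_pV2 ?posrE ?sqrtr_gt0 ?invr_gt0//.
rewrite -[leLHS]gtr0_norm ?invr_gt0// -sqrtr_sqr ler_wsqrtr//.
by near: n; exact: nbhs_infty_ger.
Unshelve. all: by end_near. Qed.

End elementary_bounds.

Section iid_expectation.
Context {R : realType} (A : finType) (q : A -> R).

(* The expectation of F over n independent draws from the weights q. *)
Fixpoint iidE n (F : seq A -> R) : R :=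
  if n is n'.+1 then \sum_a q a * iidE n' (fun s => F (a :: s)) else F [::].

Lemma iidED n F G : iidE n (fun s => F s + G s) = iidE n F + iidE n G.
Proof.
elim: n F G => //= n IH F G; rewrite -big_split/=.
by apply: eq_bigr => a _; rewrite IH mulrDr.
Qed.

Lemma iidE_sum n (I : Type) (r : seq I) (F : I -> seq A -> R) :
  iidE n (fun s => \sum_(i <- r) F i s) = \sum_(i <- r) iidE n (F i).
Proof.
elim: n F => //= n IH F; rewrite exchange_big/=; apply: eq_bigr => a _.
by rewrite (IH (fun i s => F i (a :: s))) mulr_sumr.
Qed.

Lemma iidEZ n k F : iidE n (fun s => k * F s) = k * iidE n F.
Proof.
elim: n F => //= n IH F; rewrite mulr_sumr.
by apply: eq_bigr => a _; rewrite IH mulrCA.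
Qed.

Lemma iidEN n F : iidE n (fun s => - F s) = - iidE n F.
Proof.
rewrite -mulN1r -iidEZ; congr iidE.
by apply/funext => s; rewrite mulN1r.
Qed.

Lemma iidEB n F G : iidE n (fun s => F s - G s) = iidE n F - iidE n G.
Proof. by rewrite iidED iidEN. Qed.

Lemma eq_iidE n F G : (forall s, size s = n -> F s = G s) ->
  iidE n F = iidE n G.
Proof.
elim: n F G => /= [F G ->//|n IH F G FG].
apply: eq_bigr => a _; congr (_ * _); apply: IH => s sn.
by apply: FG; rewrite /= sn.
Qed.

Hypothesis q0 : forall a, 0 <= q a.

Lemma iidE_le n F G : (forall s, size s = n -> F s <= G s) ->
  iidE n F <= iidE n G.
Proof.
elim: n F G => /= [F G ->//|n IH F G FG].
apply: ler_sum => a _; rewrite ler_wpM2l//; apply: IH => s sn.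
by apply: FG; rewrite /= sn.
Qed.

Lemma iidE_norm n F : `|iidE n F| <= iidE n (fun s => `|F s|).
Proof.
rewrite ler_norml -iidEN; apply/andP; split; apply: iidE_le => s _.
  by rewrite lerNl -normrN ler_norm.
exact: ler_norm.
Qed.

Hypothesis q1 : \sum_a q a = 1.

Lemma iidE_cst n k : iidE n (fun=> k) = k.
Proof. by elim: n => //= n IH; rewrite IH -mulr_suml q1 mul1r. Qed.

Lemma iidE_sqr_sum n (z : A -> R) : \sum_a q a * z a = 0 ->
  iidE n (fun s => (\sum_(a <- s) z a) ^+ 2) = n%:R * \sum_a q a * z a ^+ 2.
Proof.
move=> z0.
(* The recursion exposes the first draw, which is absorbed into the offset [k]. The cross term is
   linear in [z a] and vanishes by centring. *)
suff H k : iidE n (fun s => (k + \sum_(a <- s) z a) ^+ 2) =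
    k ^+ 2 + n%:R * \sum_a q a * z a ^+ 2.
  have := H 0; rewrite expr0n/= add0r => <-.
  by apply: eq_iidE => s _; rewrite add0r.
elim: n k => /= [|n IH] k; first by rewrite big_nil mul0r !addr0.
transitivity (\sum_a (q a * (k ^+ 2 + n%:R * (\sum_b q b * z b ^+ 2)) +
   (q a * z a) * (2 * k) + q a * z a ^+ 2)).
  apply: eq_bigr => a _.
  rewrite (@eq_iidE _ _ (fun s => (k + z a + \sum_(b <- s) z b) ^+ 2)).
    by rewrite IH; ring.
  by move=> s _; rewrite big_cons addrA.
rewrite !big_split/= -!mulr_suml q1 z0 -natr1.
by ring.
Qed.

Lemma weighted_sum_norm (f : A -> R) M : (forall a, `|f a| <= M) ->
  `|\sum_a q a * f a| <= M.
Proof.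
move=> fM; rewrite (le_trans (ler_norm_sum _ _ _))//.
apply: (@le_trans _ _ (\sum_a q a * M)); last by rewrite -mulr_suml q1 mul1r.
by apply: ler_sum => a _; rewrite normrM (ger0_norm (q0 a)) ler_wpM2l.
Qed.

(* Replacing the draws one at a time: each replaces a factor rho by a step that
   is eta-close to it, uniformly in the phase t. *)
Lemma iidE_cos_dist (h : A -> R) (rho eta : R) n th : 0 <= rho <= 1 ->
  (forall t, `|\sum_a q a * cos (t + h a) - rho * cos t| <= eta) ->
  `|iidE n (fun s => cos (th + \sum_(a <- s) h a)) - rho ^+ n * cos th| <=
  n%:R * eta.
Proof.
move=> /andP[r0 r1] heta.
elim: n th => [|n IH] th /=; first by rewrite big_nil addr0 mul1r subrr normr0 mul0r.
have -> : \sum_a q a * iidE n (fun s => cos (th + \sum_(b <- a :: s) h b)) -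
    rho ^+ n.+1 * cos th =
  \sum_a q a * (iidE n (fun s => cos (th + h a + \sum_(b <- s) h b)) -
     rho ^+ n * cos (th + h a)) +
  rho ^+ n * (\sum_a q a * cos (th + h a) - rho * cos th).
  rewrite mulrBr mulrA -exprSr addrA; congr (_ - _).
  rewrite mulr_sumr -big_split/=; apply: eq_bigr => a _.
  rewrite mulrCA -mulrDr subrK; congr (_ * _).
  by apply: eq_iidE => s _; rewrite big_cons addrA.
rewrite -natr1 mulrDl mul1r (le_trans (ler_normD _ _))// lerD//.
  exact: weighted_sum_norm.
rewrite normrM ger0_norm ?exprn_ge0//.
by rewrite (le_trans _ (heta th))// ler_piMl// exprn_ile1.
Qed.

(** The addition formula separates cosine and sine parts. Centring removes the first-order sine
    term, and the second-order cosine term agrees with that of the exponential. The remainders give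
    [B ^+ 3] (sine), [B ^+ 4] (cosine) and [v ^+ 2] (exponential); [s <= 1] reduces every power of
    [s] to the cube. *)
Lemma cos_step_dist (z : A -> R) (B s t v : R) : \sum_a q a * z a = 0 ->
  (forall a, `|z a| <= B) -> 0 <= s <= 1 -> v = \sum_a q a * z a ^+ 2 ->
  `|\sum_a q a * cos (t + s * z a) - expR (- (s ^+ 2 * v / 2)) * cos t| <=
  (B ^+ 3 + B ^+ 4 + v ^+ 2) * s ^+ 3.
Proof.
move=> z0 zB /andP[s0 s1] vE.
have v0 : 0 <= v by rewrite vE sumr_ge0// => a _; rewrite mulr_ge0// sqr_ge0.
have -> : \sum_a q a * cos (t + s * z a) - expR (- (s ^+ 2 * v / 2)) * cos t =
  cos t * ((\sum_a q a * (cos (s * z a) - 1 + (s * z a) ^+ 2 / 2)) -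
    (expR (- (s ^+ 2 * v / 2)) - 1 + s ^+ 2 * v / 2)) -
  sin t * (\sum_a q a * (sin (s * z a) - s * z a)).
  have -> : \sum_a q a * (cos (s * z a) - 1 + (s * z a) ^+ 2 / 2) =
    \sum_a q a * cos (s * z a) - 1 + s ^+ 2 * v / 2.
    transitivity (\sum_a (q a * cos (s * z a) - q a +
        q a * z a ^+ 2 * (s ^+ 2 / 2))).
      by apply: eq_bigr => a _; field.
    by rewrite !big_split/= sumrN -mulr_suml q1 -vE; field.
  have -> : \sum_a q a * (sin (s * z a) - s * z a) = \sum_a q a * sin (s * z a).
    under eq_bigr do rewrite mulrBr.
    rewrite sumrB; under [X in _ - X]eq_bigr do rewrite mulrCA.
    by rewrite -mulr_sumr z0 mulr0 subr0.
  have -> : \sum_a q a * cos (t + s * z a) =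
     cos t * (\sum_a q a * cos (s * z a)) - sin t * (\sum_a q a * sin (s * z a)).
    rewrite !mulr_sumr -sumrB; apply: eq_bigr => a _.
    by rewrite cosD; ring.
  by ring.
have s3 : s ^+ 4 <= s ^+ 3 by rewrite exprSr ler_piMr// exprn_ge0.
(* [B] is nonnegative only through a value [z a] that it bounds, so an element of [A] is an
   argument. *)
have B0 (a : A) : 0 <= B by exact: le_trans (normr_ge0 _) (zB a).
have E1 : `|\sum_a q a * (cos (s * z a) - 1 + (s * z a) ^+ 2 / 2)| <=
    B ^+ 4 * s ^+ 3.
  apply: weighted_sum_norm => a; rewrite (le_trans (cos_quartic _))//.
  rewrite normrM (ger0_norm s0) exprMn mulrC ler_pM ?exprn_ge0//.
  by rewrite lerXn2r ?nnegrE// (B0 a).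
have E2 : `|\sum_a q a * (sin (s * z a) - s * z a)| <= B ^+ 3 * s ^+ 3.
  apply: weighted_sum_norm => a; rewrite (le_trans (sin_cubic _))//.
  rewrite normrM (ger0_norm s0) exprMn mulrC ler_wpM2r// ?exprn_ge0//.
  by rewrite lerXn2r ?nnegrE// (B0 a).
clear B0; have E3 : `|expR (- (s ^+ 2 * v / 2)) - 1 + s ^+ 2 * v / 2| <= v ^+ 2 * s ^+ 3.
  have sv0 : 0 <= s ^+ 2 * v / 2 by rewrite divr_ge0// mulr_ge0// sqr_ge0.
  rewrite (le_trans (expRN_quadratic sv0))//.
  have -> : (s ^+ 2 * v / 2) ^+ 2 = v ^+ 2 * (s ^+ 4 / 4) by field.
  rewrite ler_wpM2l ?sqr_ge0//; have := exprn_ge0 4 s0; lra.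
have E4 : `|sin t * (\sum_a q a * (sin (s * z a) - s * z a))| <= B ^+ 3 * s ^+ 3.
  by rewrite normrM (le_trans _ E2)// ler_piMl// sin_max.
rewrite (le_trans (ler_normB _ _))//.
have -> : (B ^+ 3 + B ^+ 4 + v ^+ 2) * s ^+ 3 =
  (B ^+ 4 * s ^+ 3 + v ^+ 2 * s ^+ 3) + B ^+ 3 * s ^+ 3 by ring.
rewrite lerD// normrM (le_trans (ler_piMl _ (cos_max t)))//.
by rewrite (le_trans (ler_normB _ _))// lerD.
Qed.

(** With [s = 1 / sqrt n], each of the [n] replacements costs [K * s ^+ 3], in total [K * s], while
    the [n]-th power of the one-step factor is exactly the Gaussian factor. *)
Lemma iidE_cos_cvg (z : A -> R) th : \sum_a q a * z a = 0 ->
  iidE n (fun s => cos (th + (\sum_(a <- s) z a) / Num.sqrt n%:R)) @[n --> \oo]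
  --> expR (- ((\sum_a q a * z a ^+ 2) / 2)) * cos th.
Proof.
move=> z0; set v := \sum_a _.
pose B := \sum_a `|z a|.
have zB a : `|z a| <= B by rewrite /B (bigD1 a)//= lerDl sumr_ge0.
pose K := B ^+ 3 + B ^+ 4 + v ^+ 2.
have v0 : 0 <= v by rewrite /v sumr_ge0// => a _; rewrite mulr_ge0// sqr_ge0.
have H : \forall n \near \oo, `|expR (- (v / 2)) * cos th -
   iidE n (fun s => cos (th + (\sum_(a <- s) z a) / Num.sqrt n%:R))| <= K * (Num.sqrt n%:R)^-1.
  near=> n.
  have n0 : (0 < n)%N by near: n; exact: nbhs_infty_gt.
  have n0R : (0 : R) < n%:R by rewrite ltr0n.
  pose s := (Num.sqrt (n%:R : R))^-1.
  have s0 : 0 <= s by rewrite invr_ge0 sqrtr_ge0.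
  have s1 : s <= 1.
    by rewrite invf_le1 ?sqrtr_gt0// -[leLHS]sqrtr1 ler_wsqrtr// ler1n.
  have sn : s ^+ 2 * n%:R = 1.
    by rewrite /s exprVn sqr_sqrtr ?ler0n// mulVf// gt_eqF.
  have := @iidE_cos_dist (fun a => s * z a) (expR (- (s ^+ 2 * v / 2))) (K * s ^+ 3) n th.
  rewrite expR_ge0 expR_le1 oppr_le0.
  have -> : 0 <= s ^+ 2 * v / 2 by rewrite divr_ge0// mulr_ge0// sqr_ge0.
  have s01 : 0 <= s <= 1 by rewrite s0.
  move=> /(_ isT (fun t => @cos_step_dist z B s t v z0 zB s01 erefl)).
  have -> : n%:R * (K * s ^+ 3) = K * s.
    by transitivity (K * s * (s ^+ 2 * n%:R)); [ring|rewrite sn mulr1].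
  rewrite -expRM_natl.
  have -> : n%:R * - (s ^+ 2 * v / 2) = - (v / 2).
    by transitivity (- (v / 2) * (s ^+ 2 * n%:R)); [field|rewrite sn mulr1].
  rewrite distrC; congr (`|_ - _| <= _).
  by apply: eq_iidE => l _; rewrite mulr_suml; congr (cos (_ + _)); apply: eq_bigr => a _; rewrite mulrC.
have sq0 : K * (Num.sqrt n%:R)^-1 @[n --> \oo] --> (0 : R).
  by rewrite -(mulr0 K); apply: cvgMl_tmp; exact: cvg_sqrtnV0.
apply/cvgrPdist_le => e e0.
have /cvgrPdist_le/(_ _ e0) := sq0.
apply: filterS2 H => n H1; rewrite sub0r normrN => H2.
by rewrite (le_trans H1)// (le_trans (ler_norm _)).
Unshelve. all: by end_near.
Qed.

End iid_expectation.

(** * Trigonometric approximation on boxes *)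

(** Only [x] has to lie in the compact set. This matters when [y] is an interpolation node or a
    value that may fall outside it. The halved radii leave room for moving both points. *)
Lemma uniform_continuous_compact (R : realType) (V : normedModType R)
    (A : set V) (g : V -> R) e : compact A -> continuous g -> 0 < e ->
  exists2 d, 0 < d &
    forall x y, A x -> `|y - x| < d -> `|g y - g x| < e.
Proof.
move=> /compact_near_coveringP + gc e0.
move=> /(_ R 0^'+ (fun d x => forall y, `|y - x| < d -> `|g y - g x| < e) _).
have H x : A x -> \forall x' \near x & d \near 0^'+,
    forall y, `|y - x'| < d -> `|g y - g x'| < e.
  move=> _.
  have e20 : 0 < e / 2 by rewrite divr_gt0.
  have /cvgrPdist_lt/(_ _ e20)/nbhs_ballP[d /= d0 dg] := gc x.
  exists (ball x (d / 2), [set d' | d' < d / 2]) => /=.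
    split; first by apply: nbhsx_ballx; rewrite divr_gt0.
    by apply: nbhs_right_lt; rewrite divr_gt0.
  case=> x' d' /=; rewrite -ball_normE/= => -[xx' d'd] y yx'.
  have gy : `|g x - g y| < e / 2.
    apply: dg; rewrite -ball_normE/= distrC.
    rewrite -(subrKA x') (le_lt_trans (ler_normD _ _))// (splitr d) ltrD//.
      exact: lt_trans d'd.
    by rewrite distrC.
  have gx' : `|g x - g x'| < e / 2.
    apply: dg; rewrite -ball_normE/= (lt_trans xx')// gtr_pMr//.
    by rewrite invf_lt1// ltr1n.
  rewrite distrC -(subrKA (g x)) (le_lt_trans (ler_normD _ _))// (splitr e).
  by rewrite ltrD// distrC.
move=> /(_ H) K.
have [d [d0 dK]] := filter_ex (filterI (nbhs_right_gt (0:R)) K).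
by exists d => // x y xr yx; exact: dK.
Qed.

(** * Linear forms and the sup norm on row vectors *)

Section row_vectors.
Context {R : realType} {m : nat}.
Implicit Types t x y : 'rV[R]_m.

Definition dot t x : R := \sum_i t 0 i * x 0 i.

Lemma dotDl t t' x : dot (t + t') x = dot t x + dot t' x.
Proof. by rewrite -big_split; apply: eq_bigr => i _; rewrite mxE mulrDl. Qed.

Lemma dotNl t x : dot (- t) x = - dot t x.
Proof. by rewrite -sumrN; apply: eq_bigr => i _; rewrite mxE mulNr. Qed.

Lemma dotZl k t x : dot (k *: t) x = k * dot t x.
Proof. by rewrite mulr_sumr; apply: eq_bigr => i _; rewrite mxE mulrA. Qed.

Lemma dot0l x : dot 0 x = 0.
Proof. by rewrite /dot big1// => i _; rewrite mxE mul0r. Qed.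

Lemma dotC t x : dot t x = dot x t.
Proof. by apply: eq_bigr => i _; rewrite mulrC. Qed.

Lemma dot_continuous t : continuous (dot t).
Proof.
move=> x.
apply: (@cvg_big R _ +%R 0 xpredT add_continuous _ (nbhs x) _
  (fun i y => t 0 i * y 0 i) (fun i => t 0 i * x 0 i)) => i _.
by apply: cvgMl_tmp; exact: coord_continuous.
Qed.

Lemma dot_delta i x : dot (delta_mx 0 i) x = x 0 i.
Proof.
rewrite /dot (bigD1 i)//= big1 ?mxE ?eqxx ?mul1r ?addr0// => j ji.
by rewrite mxE eqxx (negbTE ji) mul0r.
Qed.

Lemma coord_le_norm x i : `|x 0 i| <= `|x|.
Proof.
rewrite [leRHS]/Num.norm/= mx_normrE; apply/bigmax_geP; right => /=.
by exists (0, i).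
Qed.

Lemma norm_le_coord x r : 0 <= r -> (forall i, `|x 0 i| <= r) -> `|x| <= r.
Proof.
move=> r0 H; rewrite [leLHS]/Num.norm/= mx_normrE; apply/bigmax_leP; split => //.
by case=> j i _ /=; rewrite (ord1 j).
Qed.

Lemma norm_lt_coord x r : 0 < r -> (forall i, `|x 0 i| < r) -> `|x| < r.
Proof.
move=> r0 H; rewrite [ltLHS]/Num.norm/= mx_normrE; apply/bigmax_ltP; split => //.
by case=> j i _ /=; rewrite (ord1 j).
Qed.

Lemma norm_ball_compact r : compact [set x : 'rV[R]_m | `|x| <= r].
Proof.
apply: bounded_closed_compact.
  by exists r; split; [exact: num_real|move=> s rs x /= /le_trans -> //; exact: ltW].
rewrite (_ : [set x | _] = (fun x : 'rV[R]_m => `|x|) @^-1` [set s | s <= r])//.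
by apply: closed_comp; [move=> x _; exact: norm_continuous|exact: closed_le].
Qed.

Lemma continuous_bounded_ball (g : 'rV[R]_m -> R) r : continuous g ->
  exists M, forall x, `|x| <= r -> `|g x| <= M.
Proof.
move=> gc; pose B := [set x : 'rV[R]_m | `|x| <= r].
have : compact (g @` B).
  apply: continuous_compact; last exact: norm_ball_compact.
  exact: continuous_subspaceT.
move=> /compact_bounded [M [_ H]].
exists (M + 1) => x xr.
by apply: (H (M + 1)); [rewrite ltrDl|exists x].
Qed.

End row_vectors.

Section trigonometric_sums.
Context {R : realType} {m : nat}.
Implicit Types f g : 'rV[R]_m -> R.

(** The phase [th] makes sines a special case. Each property proved for single cosines and stable
    under linear combinations then follows by induction on this predicate. *)
Inductive trig : ('rV[R]_m -> R) -> Prop :=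
| trig_cos th t : trig (fun x => cos (th + dot t x))
| trigD f g : trig f -> trig g -> trig (fun x => f x + g x)
| trigZ k f : trig f -> trig (fun x => k * f x).

Lemma trig_cst k : trig (fun=> k).
Proof.
rewrite (_ : (fun=> k) = fun x => k * cos (0 + dot 0 x)).
  by apply: trigZ; exact: trig_cos.
by apply/funext => x; rewrite dot0l addr0 cos0 mulr1.
Qed.

Lemma trig_sin t : trig (fun x => sin (dot t x)).
Proof.
rewrite (_ : (fun x => _) = fun x => cos (- (pi / 2) + dot t x)).
  exact: trig_cos.
by apply/funext => x; rewrite addrC cosBpihalf.
Qed.

Lemma trigM f g : trig f -> trig g -> trig (fun x => f x * g x).
Proof.
move=> tf; elim: tf g => [th t|f1 f2 _ IH1 _ IH2|k f1 _ IH1] g tg.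
- elim: tg => [th' t'|g1 g2 _ IH1 _ IH2|k g1 _ IH1].
  + rewrite (_ : (fun x => _) = fun x =>
      2^-1 * (cos ((th + th') + dot (t + t') x) +
              cos ((th - th') + dot (t - t') x))).
      by apply: trigZ; apply: trigD; exact: trig_cos.
    apply/funext => x; rewrite !dotDl dotNl.
    rewrite addrACA (addrACA th (- th')) -opprD.
    by rewrite (cosD (th + _)) (cosB (th + _)); field.
  + rewrite (_ : (fun x => _) = fun x => cos (th + dot t x) * g1 x +
      cos (th + dot t x) * g2 x); first exact: trigD.
    by apply/funext => x; rewrite mulrDr.
  + rewrite (_ : (fun x => _) = fun x => k * (cos (th + dot t x) * g1 x)).
      exact: trigZ.
    by apply/funext => x; rewrite mulrCA.
- rewrite (_ : (fun x => _) = fun x => f1 x * g x + f2 x * g x).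
    by apply: trigD; [exact: IH1|exact: IH2].
  by apply/funext => x; rewrite mulrDl.
- rewrite (_ : (fun x => _) = fun x => k * (f1 x * g x)).
    by apply: trigZ; exact: IH1.
  by apply/funext => x; rewrite mulrA.
Qed.

Lemma trig_sum (I : Type) (r : seq I) (F : I -> 'rV[R]_m -> R) :
  (forall i, trig (F i)) -> trig (fun x => \sum_(i <- r) F i x).
Proof.
move=> tF; elim: r => [|i r IH].
  by under eq_fun do rewrite big_nil; exact: trig_cst.
by under eq_fun do rewrite big_cons; exact: trigD.
Qed.

Lemma trig_prod (I : Type) (r : seq I) (F : I -> 'rV[R]_m -> R) :
  (forall i, trig (F i)) -> trig (fun x => \prod_(i <- r) F i x).
Proof.
move=> tF; elim: r => [|i r IH].
  by under eq_fun do rewrite big_nil; exact: trig_cst.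
by under eq_fun do rewrite big_cons; exact: trigM.
Qed.

(** An expectation over [n] draws is a polynomial in the weights. This is how the Bernstein averages
    are seen to be trigonometric sums. *)
Lemma trig_iidE (A : finType) (q : 'rV[R]_m -> A -> R) n (F : seq A -> R) :
  (forall a, trig (q^~ a)) -> trig (fun x => iidE (q x) n F).
Proof.
move=> tq; elim: n F => [|n IH] F /=; first exact: trig_cst.
by apply: trig_sum => a; exact: trigM.
Qed.

(** In [sin u - sin v = 2 * cos p * sin q], the half-sum [p] stays within
    [(pi / 2 + 1) / 2 < pi / 2], so its cosine is bounded below, and [d / 2 <= |q|]. The asymmetry
    is deliberate: [u] comes from a node, which may reach [pi / 2], whereas [v] comes from a point
    of the box and is at most 1 in absolute value. *)
Lemma dist_sin_ge (u v d : R) : 0 <= d -> `|u| <= pi / 2 -> `|v| <= 1 ->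
  d <= `|u - v| -> 2 * cos ((pi / 2 + 1) / 2) * sin (d / 2) <= `|sin u - sin v|.
Proof.
move=> d0 upi v1 duv.
pose p := (u + v) / 2; pose q := (u - v) / 2.
have -> : sin u - sin v = 2 * cos p * sin q.
  have -> : u = p + q by rewrite /p /q; field.
  have -> : v = p - q by rewrite /p /q; field.
  by rewrite sinD sinB; ring.
have pi1 : 1 <= pi / 2 :> R := pihalf_ge1 R.
have cp : cos ((pi / 2 + 1) / 2) <= cos p.
  rewrite -(cos_norm p) leNgt ltr_cos ?in_itv/=.
  - rewrite -leNgt /p normrM (@ger0_norm _ 2^-1) ?invr_ge0//.
    by rewrite ler_wpM2r ?invr_ge0// (le_trans (ler_normD _ _))// lerD.
  - apply/andP; split; lra.
  - rewrite normr_ge0/= /p normrM (@ger0_norm _ 2^-1) ?invr_ge0//.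
    have := ler_normD u v; lra.
have c0 : 0 <= cos ((pi / 2 + 1) / 2) :> R.
  by apply: cos_ge0_pihalf; apply/andP; split; lra.
have qE : `|q| = `|u - v| / 2.
  by rewrite /q normrM (@ger0_norm _ 2^-1) ?invr_ge0.
have uv : `|u - v| <= pi / 2 + 1.
  by rewrite (le_trans (ler_normB _ _))// lerD.
have sq : sin (d / 2) <= `|sin q|.
  have -> : `|sin q| = sin `|q|.
    rewrite -[q in LHS]mulr_sg_norm sin_sg normrM.
    have [->|q0] := eqVneq q 0; first by rewrite normr0 sin0 normr0 mulr0.
    rewrite normr_sg q0 mul1r ger0_norm// sin_ge0_pi// qE; lra.
  rewrite leNgt ltr_sin ?in_itv/= ?qE; first by rewrite -leNgt ler_wpM2r ?invr_ge0.
  - apply/andP; split; lra.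
  - apply/andP; split; lra.
rewrite !normrM (@ger0_norm _ 2)// -!mulrA ler_wpM2l//.
rewrite (le_trans (ler_wpM2l c0 sq))// ler_wpM2r//.
by rewrite (le_trans cp)// ler_norm.
Qed.

End trigonometric_sums.

(** * Bernstein averages over independent coins *)

Section trigonometric_approximation.
Context {R : realType} {m : nat}.
Variables (L : R) (L0 : 0 < L).
Implicit Types x : 'rV[R]_m.

Let u x i : R := (1 + sin (x 0 i / L)) / 2.

(* m independent coins, the i-th with bias u x i. *)
Let coins x (b : {ffun 'I_m -> bool}) : R :=
  \prod_i (if b i then u x i else 1 - u x i).

Let u01 x i : 0 <= u x i <= 1.
Proof.
have := sin_geN1 (x 0 i / L); have := sin_le1 (x 0 i / L).
by rewrite /u => ? ?; apply/andP; split; lra.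
Qed.

Let coins_ge0 x b : 0 <= coins x b.
Proof.
apply: prodr_ge0 => i _; have /andP[? ?] := u01 x i.
by case: ifP; rewrite ?subr_ge0.
Qed.

Let coins_sum x : \sum_b coins x b = 1.
Proof.
rewrite -(bigA_distr_bigA (fun i (b : bool) => if b then u x i else 1 - u x i)).
by rewrite big1// => i _; rewrite big_bool/= subrKC.
Qed.

Let coins_mean x i : \sum_b coins x b * ((b i)%:R - u x i) = 0.
Proof.
transitivity (\sum_(b : {ffun 'I_m -> bool}) \prod_j
  ((if b j then u x j else 1 - u x j) *
   (if j == i then (b j)%:R - u x j else 1))).
  apply: eq_bigr => b _; rewrite big_split/=; congr (_ * _).
  by rewrite -big_mkcond/= big_pred1_eq.
rewrite -(bigA_distr_bigA (fun j (b : bool) =>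
  ((if b then u x j else 1 - u x j) * (if j == i then b%:R - u x j else 1)))).
rewrite (bigD1 i)//= big_bool/= eqxx.
have -> : u x i * (1 - u x i) + (1 - u x i) * (0%:R - u x i) = 0 by ring.
by rewrite mul0r.
Qed.

Let coins_trig b : trig (coins^~ b).
Proof.
have tu i : trig (u^~ i).
  rewrite (_ : u^~ i = fun x => 2^-1 + 2^-1 * sin (dot (L^-1 *: delta_mx 0 i) x)).
    by apply: trigD; [exact: trig_cst|apply: trigZ; exact: trig_sin].
  by apply/funext => x; rewrite dotZl dot_delta /u (mulrC L^-1); field.
apply: (trig_prod _ (F := fun i x => if b i then u x i else 1 - u x i)) => i.
case: (b i); first exact: tu.
apply: trigD; first exact: trig_cst.
rewrite (_ : (fun x => _) = fun x => -1 * u x i); first exact: trigZ.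
by apply/funext => x; rewrite mulN1r.
Qed.

(** The inverse of the change of variables [u], evaluated at the observed frequencies. Since [asin]
    is bounded by [pi / 2 < 2], all nodes have norm at most [2 * L]; this is the radius on which
    [trig_approx] asks for the bound [M]. *)
Let node (s : seq {ffun 'I_m -> bool}) : 'rV[R]_m :=
  \row_i (L * asin (2 * ((\sum_(b <- s) (b i)%:R) / (size s)%:R) - 1)).

Let freq_bounds (s : seq {ffun 'I_m -> bool}) i : (0 < size s)%N ->
  0 <= (\sum_(b <- s) (b i)%:R : R) / (size s)%:R <= 1.
Proof.
move=> s0; rewrite divr_ge0 ?sumr_ge0//= ler_pdivrMr ?ltr0n// mul1r.
elim: s {s0} => [|b s IH] /=; first by rewrite big_nil.
rewrite big_cons -natr1 addrC lerD//.
by case: (b i).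
Qed.

Let node_bound s i : (0 < size s)%N -> `|node s 0 i / L| <= pi / 2.
Proof.
move=> s0; rewrite mxE mulrAC divff ?gt_eqF// mul1r ler_norml.
have /andP[? ?] := freq_bounds i s0.
by rewrite asin_geNpi2 ?asin_lepi2//; apply/andP; split; lra.
Qed.

Let sin_node s i : (0 < size s)%N -> sin (node s 0 i / L) =
  2 * ((\sum_(b <- s) (b i)%:R) / (size s)%:R) - 1.
Proof.
move=> s0; rewrite mxE mulrAC divff ?gt_eqF// mul1r asinK// in_itv/=.
by have /andP[? ?] := freq_bounds i s0; apply/andP; split; lra.
Qed.

(** The variance of a mean of [n] coins is at most [1 / n]; the factor 4 comes from
    [sin = 2 * u - 1]. *)
Let freq_deviation x i n : (0 < n)%N ->
  iidE (coins x) n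
    (fun s => (sin (node s 0 i / L) - sin (x 0 i / L)) ^+ 2) <= 4 / n%:R.
Proof.
move=> n0; have nR0 : n%:R != 0 :> R by rewrite pnatr_eq0 -lt0n.
have -> : iidE (coins x) n
    (fun s => (sin (node s 0 i / L) - sin (x 0 i / L)) ^+ 2) =
  4 / n%:R ^+ 2 * iidE (coins x) n (fun s => (\sum_(b <- s) ((b i)%:R - u x i)) ^+ 2).
  rewrite -iidEZ; apply: eq_iidE => s sn.
  rewrite sin_node ?sn// sumrB big_const_seq count_predT sn iter_addr_0.
  by rewrite -mulr_natr /u; field.
rewrite (iidE_sqr_sum (coins_sum x) n (coins_mean x i)).
have H : \sum_b coins x b * ((b i)%:R - u x i) ^+ 2 <= 1.
  rewrite -[leRHS](coins_sum x) ler_sum// => b _.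
  rewrite ler_piMr// -real_normK ?num_real// expr_le1//.
  have /andP[? ?] := u01 x i.
  rewrite ler_norml; case: (b i) => /=; apply/andP; split; lra.
rewrite -[leRHS]mulr1 (_ : 4 / n%:R = 4 / n%:R ^+ 2 * n%:R); last by field.
by rewrite -!mulrA !ler_wpM2l// ?invr_ge0 ?exprn_ge0.
Qed.

(** The approximant averages [g] over the nodes, so it inherits the bound [M] at every [x]. Inside
    the box, nodes close to [x] are handled by uniform continuity and the others by Chebyshev's
    inequality: a node at distance [d] or more has a coordinate whose sine differs from that of [x]
    by at least [k]. *)
Lemma trig_approx (g : 'rV[R]_m -> R) M e : continuous g -> 0 < e ->
  (forall y, `|y| <= 2 * L -> `|g y| <= M) ->
  exists T, [/\ trig T, (forall x, `|T x| <= M) &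
    forall x, `|x| <= L -> `|T x - g x| <= e].
Proof.
move=> gc e0 gM.
have M0 : 0 <= M by rewrite (le_trans _ (gM 0 _))// normr0 mulr_ge0// ltW.
have e20 : 0 < e / 2 by rewrite divr_gt0.
have [d0 d00 gd0] := uniform_continuous_compact (@norm_ball_compact R m L) gc e20.
pose d := Num.min d0 L; have d_gt0 : 0 < d by rewrite lt_min d00.
have dL : d / L <= 1 by rewrite ler_pdivrMr// mul1r ge_min lexx orbT.
have dL0 : 0 < d / L by rewrite divr_gt0.
pose k : R := 2 * cos ((pi / 2 + 1) / 2) * sin (d / L / 2).
have k0 : 0 < k.
  have pi1 : 1 < pi / 2 :> R.
    rewrite lt_neqAle pihalf_ge1 andbT; apply/eqP => pi1.
    by have := cos1_gt0 R; rewrite pi1 cos_pihalf ltxx.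
  have pi2 : pi / 2 < 2 :> R := pihalf_lt2 R.
  rewrite !mulr_gt0//.
    apply: cos_gt0_pihalf; apply/andP; split; lra.
  apply: sin2_gt0; rewrite divr_gt0//= ltr_pdivrMr// (le_lt_trans dL)//.
  by rewrite -natrM ltr1n.
(* Enough coins for the Chebyshev term, with its [m] coordinates of variance at most [4 / N], to
   fall below [e / 2]. *)
pose N := (Num.truncn (2 * M * (m%:R * 4) / k ^+ 2 * (e / 2)^-1)).+1.
have NE : 2 * M / k ^+ 2 * (m%:R * (4 / N%:R)) <= e / 2.
  have -> : 2 * M / k ^+ 2 * (m%:R * (4 / N%:R)) =
      2 * M * (m%:R * 4) / k ^+ 2 / N%:R by ring.
  rewrite ler_pdivrMr ?ltr0n// [leRHS]mulrC -ler_pdivrMr//.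
  exact/ltW/truncnS_gt.
have node2 s : size s = N -> `|node s| <= 2 * L.
  move=> sN; apply: norm_le_coord => [|i]; first by rewrite mulr_ge0// ltW.
  have sN0 : (0 < size s)%N by rewrite sN.
  have := node_bound i sN0; rewrite normrM normfV (gtr0_norm L0) ler_pdivrMr//.
  move=> /le_trans; apply; rewrite ler_wpM2r// ltW//; exact: pihalf_lt2.
exists (fun x => iidE (coins x) N (fun s => g (node s))); split.
- exact: trig_iidE.
- move=> x; rewrite (le_trans (iidE_norm (coins_ge0 x) _ _))//.
  rewrite -[leRHS](iidE_cst (coins_sum x) N) (iidE_le (coins_ge0 x))//.
  by move=> s sN; apply: gM; exact: node2.
- move=> x xL.
  rewrite -[g x](iidE_cst (coins_sum x) N) -iidEB.
  rewrite (le_trans (iidE_norm (coins_ge0 x) _ _))//.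
  (* One integrand dominating both cases: [e / 2] covers the close nodes, and the quadratic term is
     at least [2 * M] at the distant ones. *)
  apply: (@le_trans _ _ (iidE (coins x) N (fun s => e / 2 +
    2 * M / k ^+ 2 * \sum_i (sin (node s 0 i / L) - sin (x 0 i / L)) ^+ 2))).
    apply: (iidE_le (coins_ge0 x)) => s sN.
    have sN0 : (0 < size s)%N by rewrite sN.
    have [H|H] := ltP `|node s - x| d.
      apply: le_trans (ltW (gd0 _ _ xL _)) _.
        by rewrite (lt_le_trans H)// ge_min lexx.
      rewrite lerDl mulr_ge0// ?sumr_ge0// => [|i _]; last exact: sqr_ge0.
      by rewrite divr_ge0 ?sqr_ge0// mulr_ge0.
    apply: (@le_trans _ _ (2 * M)).
      rewrite (le_trans (ler_normB _ _))// (_ : 2 * M = M + M); last by ring.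
      rewrite lerD// gM ?node2// (le_trans xL)// ler_peMl// ?ler1n//.
      exact: ltW.
    have [i di] : exists i, d <= `|node s 0 i - x 0 i|.
      apply: contrapT => /forallNP nd; move: H; apply/negP; rewrite -ltNge.
      apply: norm_lt_coord => // i; rewrite ltNge.
      by apply/negP; have := nd i; rewrite !mxE.
    have ki : k <= `|sin (node s 0 i / L) - sin (x 0 i / L)|.
      apply: dist_sin_ge; [exact: ltW|exact: node_bound| |].
        rewrite normrM normfV (gtr0_norm L0) ler_pdivrMr// mul1r.
        exact: le_trans (coord_le_norm _ _) xL.
      by rewrite -mulrBl normrM normfV (gtr0_norm L0) ler_wpM2r// invr_ge0 ltW.
    have k2 : k ^+ 2 <= (sin (node s 0 i / L) - sin (x 0 i / L)) ^+ 2.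
      by rewrite -[leRHS]real_normK ?num_real// lerXn2r// nnegrE// ltW.
    apply: (@le_trans _ _ (2 * M / k ^+ 2 *
        (sin (node s 0 i / L) - sin (x 0 i / L)) ^+ 2)).
      by rewrite mulrAC ler_pdivlMr ?exprn_gt0// ler_wpM2l// mulr_ge0.
    rewrite -[leLHS]add0r lerD//; first exact: ltW.
    rewrite ler_wpM2l ?divr_ge0 ?sqr_ge0 ?mulr_ge0//.
    by rewrite (bigD1 i)//= lerDl sumr_ge0// => j _; exact: sqr_ge0.
  rewrite iidED iidE_cst; last exact: coins_sum.
  rewrite [leRHS]splitr lerD2l iidEZ (le_trans _ NE)//.
  rewrite ler_wpM2l ?divr_ge0 ?sqr_ge0 ?mulr_ge0//.
  rewrite iidE_sum mulr_natl -[in leRHS](card_ord m) -sumr_const ler_sum// => i _.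
  exact: freq_deviation.
Qed.

End trigonometric_approximation.

(** * The characteristic function of the normal law *)

Lemma bounded_integrable (R : realType) (d : measure_display)
    (T : measurableType d) (P : probability T R) (f : T -> R) :
  measurable_fun setT f -> (exists M, forall x, `|f x| <= M) ->
  P.-integrable setT (EFin \o f).
Proof.
move=> mf [M fM]; apply: measurable_bounded_integrable => //.
  by rewrite (le_lt_trans (probability_le1 P measurableT))// ltry.
by exists M; split; [exact: num_real|move=> K MK x _; exact: le_trans (fM x) (ltW MK)].
Qed.

Lemma measurable_cosD (R : realType) (th : R) :
  measurable_fun setT (fun x : R => cos (th + x)).
Proof.
apply: continuous_measurable_fun => x.
apply: (@continuous_comp _ _ _ (fun y => th + y) cos x); last exact: continuous_cos.
by apply: cvgD; [exact: cvg_cst|exact: cvg_id].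
Qed.

Section normal_characteristic_function.
Context {R : realType}.
Notation mu := (@lebesgue_measure R).
Variables (s : R) (s0 : 0 < s) (th : R).

Let g : R -> R := normal_pdf 0 s.

Let gE x : g x = normal_peak s * expR (- x ^+ 2 / (s ^+ 2 *+ 2)).
Proof. by rewrite /g normal_pdfE ?gt_eqF// /normal_fun subr0. Qed.

Let g_ge0 x : 0 <= g x.
Proof. exact: normal_pdf_ge0. Qed.

Let g_cont : continuous g.
Proof. by apply: continuous_normal_pdf; rewrite gt_eqF. Qed.

Let g_int : mu.-integrable setT (EFin \o g).
Proof. exact: integrable_normal_pdf. Qed.

Let measurableC (h : R -> R) : continuous h -> measurable_fun setT h.
Proof. exact: continuous_measurable_fun. Qed.

Let integrable_le (h k : R -> R) : continuous h ->
  mu.-integrable setT (EFin \o k) -> (forall x, `|h x| <= k x) ->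
  mu.-integrable setT (EFin \o h).
Proof.
move=> hc ik hk; apply: le_integrable ik => //=.
  by apply/measurable_EFinP; exact: measurableC.
by move=> x _ /=; rewrite lee_fin (le_trans (hk x))// ler_norm.
Qed.

Let s' := s * Num.sqrt 2.
Let s'0 : 0 < s'. Proof. by rewrite mulr_gt0// sqrtr_gt0. Qed.
Let C := s * normal_peak s / normal_peak s'.

(** Half of the Gaussian exponent absorbs the factor [|x|], by
    [|x| <= s * (1 + x ^+ 2 / (4 * s ^+ 2))] and the exponential inequality. The other half is a
    Gaussian density of doubled variance, hence [s' = s * sqrt 2]. *)
Let xg_le x : `|x| * g x <= C * normal_pdf 0 s' x.
Proof.
have p'0 : 0 < normal_peak s' by apply: normal_peak_gt0; rewrite gt_eqF.
rewrite gE normal_pdfE ?gt_eqF// /normal_fun subr0 /C.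
have -> : s' ^+ 2 *+ 2 = s ^+ 2 * 4.
  by rewrite /s' exprMn sqr_sqrtr// -mulr_natr; ring.
have -> : s * normal_peak s / normal_peak s' *
    (normal_peak s' * expR (- x ^+ 2 / (s ^+ 2 * 4))) =
  normal_peak s * (s * expR (- x ^+ 2 / (s ^+ 2 * 4))).
  by field; rewrite gt_eqF.
rewrite mulrCA ler_wpM2l ?normal_peak_ge0//.
have -> : - x ^+ 2 / (s ^+ 2 *+ 2) =
    - x ^+ 2 / (s ^+ 2 * 4) + - x ^+ 2 / (s ^+ 2 * 4).
  by rewrite -mulr_natr; field; rewrite gt_eqF.
rewrite expRD mulrA ler_wpM2r ?expR_ge0//.
rewrite mulNr expRN ler_pdivrMr ?expR_gt0//.
have H : 1 + x ^+ 2 / (s ^+ 2 * 4) <= expR (x ^+ 2 / (s ^+ 2 * 4)) := expR_ge1Dx _.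
rewrite (le_trans _ (ler_wpM2l (ltW s0) H))// -subr_ge0.
have -> : s * (1 + x ^+ 2 / (s ^+ 2 * 4)) - `|x| = s * (1 - `|x| / (s * 2)) ^+ 2.
  by rewrite -[x ^+ 2]real_normK ?num_real//; field; rewrite gt_eqF.
by rewrite mulr_ge0 ?sqr_ge0// ltW.
Qed.

Let xg_int : mu.-integrable setT (EFin \o (fun x => `|x| * g x)).
Proof.
apply: (@integrable_le _ (fun x => C * normal_pdf 0 s' x)).
- by move=> x; apply: cvgM; [exact: norm_continuous|exact: g_cont].
- rewrite (_ : _ \o _ = fun x => C%:E * (normal_pdf 0 s' x)%:E)%E//.
  by apply: integrableZl => //; exact: integrable_normal_pdf.
- by move=> x; rewrite ger0_norm ?mulr_ge0.
Qed.

(** The real part of the characteristic function turned by the phase [th], so complex numbers are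
    avoided. It is identified through the equation [F' = - s ^+ 2 * t * F]. *)
Let F t := \int[mu]_x (cos (th + t * x) * g x).

Let f_cont t : continuous (fun x : R => cos (th + t * x) * g x).
Proof.
move=> x; apply: cvgM; last exact: g_cont.
apply: (@continuous_comp _ _ _ (fun y => th + t * y) cos x); last exact: continuous_cos.
by apply: cvgD; [exact: cvg_cst|apply: cvgMl_tmp; exact: cvg_id].
Qed.

Let df_cont t : continuous (fun x : R => - x * sin (th + t * x) * g x).
Proof.
move=> x; apply: cvgM; last exact: g_cont.
apply: cvgM; first by apply: cvgN; exact: cvg_id.
apply: (@continuous_comp _ _ _ (fun y => th + t * y) sin x); last exact: continuous_sin.
by apply: cvgD; [exact: cvg_cst|apply: cvgMl_tmp; exact: cvg_id].
Qed.

Let f_int t : mu.-integrable setT (EFin \o (fun x => cos (th + t * x) * g x)).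
Proof.
apply: (@integrable_le _ g) => // x.
by rewrite normrM (ger0_norm (g_ge0 x)) ler_piMl// cos_max.
Qed.

Let df_int t :
  mu.-integrable setT (EFin \o (fun x => - x * sin (th + t * x) * g x)).
Proof.
apply: (@integrable_le _ (fun x => `|x| * g x)) => // x.
rewrite !normrM normrN (ger0_norm (g_ge0 x)) ler_wpM2r//.
by rewrite ler_piMr// sin_max.
Qed.

Let derive_f (t x : R) :
  is_derive t 1 (fun t : R => cos (th + t * x) * g x) (- x * sin (th + t * x) * g x).
Proof.
apply: is_derive_eq; rewrite /GRing.scale/=; ring.
Qed.

Let derive_F (t : R) : is_derive t 1 F (\int[mu]_x (- x * sin (th + t * x) * g x)).
Proof.
have Ia : `](t - 1), (t + 1)[%classic t.
  by rewrite /= in_itv/= ltrBlDr ltrDl ltr01.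
have dE y x : partial1of2 (fun t x : R => cos (th + t * x) * g x) y x =
    - x * sin (th + y * x) * g x.
  by rewrite partial1of2E; exact: derive_val.
have H1 (x y : R) : `](t - 1), (t + 1)[%classic x -> setT y ->
  derivable (fun t : R => cos (th + t * y) * g y) x 1.
  by move=> _ _; exact: ex_derive.
have H2 (x y : R) : `](t - 1), (t + 1)[%classic x -> setT y ->
  `|partial1of2 (fun t x : R => cos (th + t * x) * g x) x y| <= `|y| * g y.
  move=> _ _; rewrite dE !normrM normrN (ger0_norm (g_ge0 y)) ler_wpM2r//.
  by rewrite ler_piMr// sin_max.
have H0 y : 0 <= `|y| * g y by rewrite mulr_ge0.
apply: DeriveDef.
  exact: (derivable_under_integral measurableT Ia (fun x _ => f_int x) H1 H0 xg_int H2).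
rewrite -derive1E.
rewrite (differentiation_under_integral measurableT Ia (fun x _ => f_int x) H1 H0 xg_int H2).
by apply: eq_Rintegral => x _; rewrite dE.
Qed.

Let derive_g (x : R) : is_derive x 1 g (- x / s ^+ 2 * g x).
Proof.
rewrite (_ : g = fun y => normal_peak s * expR (- y ^+ 2 / (s ^+ 2 *+ 2))).
  apply: is_derive_eq; rewrite /GRing.scale/= -mulr_natr.
  by field; rewrite gt_eqF.
by apply/funext => y; exact: gE.
Qed.

(** [H] is the boundary term of an integration by parts: it vanishes at both infinities, and the
    integral of its derivative [h] combines [F] and its derivative into the differential
    equation. *)
Let H t x := sin (th + t * x) * g x.
Let h t x := t * (cos (th + t * x) * g x) + s ^- 2 * (- x * sin (th + t * x) * g x).

Let derive_H (t x : R) : is_derive x 1 (H t) (h t x).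
Proof.
have dg := derive_g x; rewrite /H /h.
apply: is_derive_eq; rewrite /GRing.scale/=.
by field; rewrite gt_eqF.
Qed.

Let h_cont t : continuous (h t).
Proof.
by move=> x; apply: cvgD; apply: cvgMl_tmp; [exact: f_cont|exact: df_cont].
Qed.

Let h_int t : mu.-integrable setT (EFin \o h t).
Proof.
rewrite (_ : _ \o _ = (fun x => t%:E * (cos (th + t * x) * g x)%:E) \+
  (fun x => (s ^- 2)%:E * (- x * sin (th + t * x) * g x)%:E))%E//.
by apply: integrableD => //; apply: integrableZl => //; [exact: f_int|exact: df_int].
Qed.

Let int_h_eq0 t : (\int[mu]_x (h t x)%:E = 0)%E.
Proof.
pose I n := `[(- (n.+1%:R : R)), n.+1%:R]%classic.
have mI n : measurable (I n) by exact: measurable_itv.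
have [_ _ cvgI] : [/\ mu.-integrable setT (EFin \o h t),
   (\int[mu]_x `|((EFin \o h t) \_ (I n)) x - (h t x)%:E| @[n --> \oo] --> 0)%E &
   (\int[mu]_x ((EFin \o h t) \_ (I n)) x @[n --> \oo] --> \int[mu]_x (h t x)%:E)%E].
  apply: (@dominated_convergence _ _ _ mu setT measurableT _ _ (abse \o (EFin \o h t))).
  - move=> n; apply/(measurable_restrictT _ (mI n)).
    by apply/measurable_funTS; have /integrableP[] := h_int t.
  - by have /integrableP[] := h_int t.
  - apply: aeW => x _; apply: cvg_near_cst.
    near=> n; rewrite patchE mem_set// /I/= in_itv/= -ler_norml ltW//.
    rewrite (lt_trans (truncnS_gt _))// ltr_nat ltnS.
    by near: n; exact: nbhs_infty_gt.
  - exact: integrable_abse.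
  - apply: aeW => x n _ /=; rewrite patchE; case: ifPn => _ //=.
    by rewrite normr0 lee_fin.
have cvg0 : (\int[mu]_x ((EFin \o h t) \_ (I n)) x @[n --> \oo] --> 0)%E.
  under eq_fun do rewrite -integral_mkcond.
  have FTC n : (\int[mu]_(x in I n) (h t x)%:E)%E =
      ((H t n.+1%:R)%:E - (H t (- n.+1%:R))%:E)%E.
    apply: continuous_FTC2.
    - by rewrite gtrN.
    - exact: continuous_subspaceT.
    - have Hc x : {for x, continuous (H t)}.
        exact/differentiable_continuous/derivable1_diffP/ex_derive.
      split; first by move=> x _; exact: ex_derive.
        exact: (cvg_at_right_filter (Hc _)).
      exact: (cvg_at_left_filter (Hc _)).
    - by move=> x _; rewrite derive1E; exact: derive_val.
  under eq_fun do rewrite FTC -EFinB.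
  apply: cvg_EFin; first exact: nearW.
  (* Bounding the widened density by its peak turns [xg_le] into a decay of order [1 / |x|] for the
     boundary term. *)
  pose K := C * normal_peak s'.
  have HK x : x != 0 -> `|H t x| <= K / `|x|.
    move=> x0; rewrite ler_pdivlMr ?normr_gt0// mulrC normrM (ger0_norm (g_ge0 x)).
    rewrite mulrCA (le_trans (ler_piMl _ (sin_max _)))// ?mulr_ge0//.
    rewrite (le_trans (xg_le x))// ler_wpM2l//.
      by rewrite !mulr_ge0 ?invr_ge0 ?normal_peak_ge0// ltW.
    by apply: normal_pdf_ub; rewrite gt_eqF.
  apply: (@squeeze_cvgr _ _ _ _ (fun n => - (2 * K * n.+1%:R^-1)) (fun n => 2 * K * n.+1%:R^-1)).
  - apply: nearW => n /=; rewrite -ler_norml.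
    rewrite (le_trans (ler_normB _ _))// -mulrA mulr_natl mulr2n lerD//.
      by rewrite (le_trans (HK _ _))// gtr0_norm.
    by rewrite (le_trans (HK _ _)) ?oppr_eq0// normrN gtr0_norm.
  - rewrite -oppr0 -(mulr0 (2 * K)); apply: cvgN; apply: cvgMl_tmp; exact: cvg_harmonic.
  - rewrite -(mulr0 (2 * K)); apply: cvgMl_tmp; exact: cvg_harmonic.
exact: cvg_unique cvgI cvg0.
Unshelve. all: by end_near. Qed.

Let ode t : \int[mu]_x (- x * sin (th + t * x) * g x) = - s ^+ 2 * t * F t.
Proof.
have : \int[mu]_x h t x = 0 by rewrite /Rintegral int_h_eq0.
rewrite /h RintegralD//; last 2 first.
- rewrite (_ : _ \o _ = (fun x => t%:E * (cos (th + t * x) * g x)%:E))%E//.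
  by apply: integrableZl => //; exact: f_int.
- rewrite (_ : _ \o _ = (fun x => (s ^- 2)%:E * (- x * sin (th + t * x) * g x)%:E))%E//.
  by apply: integrableZl => //; exact: df_int.
rewrite (RintegralZl _ measurableT (f_int t)).
rewrite (RintegralZl _ measurableT (df_int t)).
rewrite -/(F t) => /eqP; rewrite addrC addr_eq0 => /eqP E.
apply: (@mulfI _ (s ^- 2)); first by rewrite invr_neq0// expf_neq0// gt_eqF.
by rewrite E; field; rewrite gt_eqF.
Qed.

Lemma integral_cos_normal_pdf :
  \int[mu]_x (cos (th + x) * normal_pdf 0 s x) = expR (- (s ^+ 2 / 2)) * cos th.
Proof.
(* The integrating factor makes [E] constant; its values at 0 and 1 are then compared. *)
pose E t : R := F t * expR (s ^+ 2 / 2 * t ^+ 2).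
have dE (t : R) : is_derive t 1 E 0.
  have dF := derive_F t; apply: is_derive_eq.
  by rewrite ode /GRing.scale/=; field.
have := is_derive_0_is_cst 0 1 dE.
have F0 : F 0 = cos th.
  rewrite /F; under eq_Rintegral do rewrite mul0r addr0.
  by rewrite RintegralZl// /Rintegral integral_normal_pdf mulr1.
have F1 : F 1 = \int[mu]_x (cos (th + x) * normal_pdf 0 s x).
  by apply: eq_Rintegral => x _; rewrite mul1r.
rewrite /E F0 F1 expr0n/= mulr0 expR0 mulr1 expr1n mulr1 => ->.
by rewrite mulrC expRN mulfK// gt_eqF// expR_gt0.
Qed.

(** The Radon-Nikodym derivative of the normal law has the same integrals over measurable sets as
    the explicit density, so the two agree almost everywhere. *)
Let integral_normal_prob (f : R -> R) : measurable_fun setT f ->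
  (exists M, forall x, `|f x| <= M) ->
  (\int[normal_prob 0 s]_x (f x)%:E = \int[mu]_x (f x * normal_pdf 0 s x)%:E)%E.
Proof.
move=> mf fM.
have fint := bounded_integrable (normal_prob 0 s) mf fM.
rewrite -(Radon_Nikodym_change_of_variables (normal_prob_dominates 0 s))//=.
apply: ae_eq_integral => //.
- apply: emeasurable_funM; first exact/measurable_EFinP.
  apply: (measurable_int mu); apply: Radon_Nikodym_integrable.
  exact: normal_prob_dominates.
- apply/measurable_EFinP; apply: measurable_funM => //.
  exact: measurable_normal_pdf.
- under [X in ae_eq _ _ _ X]eq_fun do rewrite EFinM.
  apply: ae_eqe_mul2l => /=.
  rewrite Radon_NikodymE//=; first exact: normal_prob_dominates.
  move=> abmu; case: cid => /= h1 [h2 h3 h4].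
  apply: integral_ae_eq => //=.
    by apply/measurable_EFinP; exact: measurable_normal_pdf.
  by move=> E E01 mE; rewrite -h4.
Qed.

Lemma integral_cos_normal_prob :
  (\int[normal_prob 0 s]_x (cos (th + x))%:E =
   (expR (- (s ^+ 2 / 2)) * cos th)%:E)%E.
Proof.
have f1 := f_int 1.
rewrite integral_normal_prob; first last.
- by exists 1 => x; exact: cos_max.
- exact: measurable_cosD.
rewrite -integral_cos_normal_pdf /Rintegral fineK//.
rewrite (_ : (fun x => _) = EFin \o (fun x => cos (th + 1 * x) * g x)).
  exact: integrable_fin_num.
by apply/funext => x /=; rewrite mul1r.
Qed.

End normal_characteristic_function.

(** [normal_law] is a mere set function; integration needs a measure [nu] that agrees with it. The
    degenerate case is integration against a Dirac mass. *)
Lemma integral_cos_normal_law (R : realType) (v th : R)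
    (nu : {measure set (measurableTypeR R) -> \bar R}) : 0 <= v ->
  (forall A, measurable A -> nu A = normal_law 0 v A) ->
  (\int[nu]_x (cos (th + x))%:E = (expR (- (v / 2)) * cos th)%:E)%E.
Proof.
move=> v0 nuE; have [v00|v00] := eqVneq v 0.
  rewrite (eq_measure_integral (\d_(0 : measurableTypeR R))) => [|A mA _]; last first.
    by rewrite nuE// /normal_law v00 eqxx.
  rewrite integral_dirac//= ?v00 ?mul0r ?oppr0 ?expR0 ?mul1r ?addr0 ?diracT ?mul1e//.
  by apply/measurable_EFinP; exact: measurable_cosD.
transitivity (\int[normal_prob 0 (Num.sqrt v)]_x (cos (th + x))%:E)%E.
  apply: eq_measure_integral => A mA _.
  by rewrite nuE// /normal_law (negbTE v00).
rewrite integral_cos_normal_prob ?sqr_sqrtr//.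
by rewrite sqrtr_gt0 lt_neqAle eq_sym v00.
Qed.

Lemma expectation_cos_normal_law (R : realType) (d : measure_display)
    (W : measurableType d) (P : probability W R) (X : W -> R) (v th : R) :
  0 <= v -> measurable_fun setT X ->
  (forall A : set R, measurable A -> P (X @^-1` A) = normal_law 0 v A) ->
  (\int[P]_w (cos (th + X w))%:E = (expR (- (v / 2)) * cos th)%:E)%E.
Proof.
move=> v0 mX XE.
have mX' : measurable_fun setT (X : W -> measurableTypeR R) := mX.
pose nu := pushforward P (X : W -> measurableTypeR R).
rewrite -(@integral_cos_normal_law R v th nu v0 XE).
rewrite integral_pushforward//.
  by apply/measurable_EFinP; exact: measurable_cosD.
apply: bounded_integrable.
  by apply: (measurableT_comp (measurable_cosD th)).
by exists 1 => w; exact: cos_max.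
Qed.

(** * Subgradients of convex functions at interior points *)

Section sublinear.
Context {R : realType} {m : nat}.
Implicit Types (s f : 'rV[R]_m -> R) (h v : 'rV[R]_m).

Definition sublinear s :=
  (forall k h, 0 <= k -> s (k *: h) = k * s h) /\
  (forall h h', s (h + h') <= s h + s h').

Lemma sublinear0 s : sublinear s -> s 0 = 0.
Proof. by case=> /(_ 0 0 (lexx _)); rewrite scaler0 mul0r. Qed.

Lemma sublinear_oppr_ge s h : sublinear s -> - s (- h) <= s h.
Proof.
move=> ss; rewrite lerNl -subr_ge0 opprK addrC.
by have := ss.2 h (- h); rewrite subrr sublinear0.
Qed.

(* The witness f h = inf_(t >= 0) (s (h + t v) - t s v) lies below s and is
   linear on the line spanned by v; iterating over a basis makes it linear. *)
Lemma sublinear_step s v : sublinear s ->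
  exists f, [/\ sublinear f, (forall h, f h <= s h) & f (- v) <= - s v].
Proof.
move=> ss; have [sZ sD] := ss.
pose S h := [set r | exists2 t, 0 <= t & r = s (h + t *: v) - t * s v].
(* Subadditivity applied to [t *: v = (h + t *: v) + (- h)]; it makes the infimum finite. *)
have Slb h : lbound (S h) (- s (- h)).
  move=> _ [t t0 ->]; rewrite -(sZ t v t0) lerBrDr -lerBrDl opprK.
  by have := sD (h + t *: v) (- h); rewrite addrAC subrr add0r.
have Sne h : S h !=set0 by exists (s (h + 0 *: v) - 0 * s v), 0.
have Shas h : has_inf (S h) by split => //; exists (- s (- h)).
have Sle h t : 0 <= t -> inf (S h) <= s (h + t *: v) - t * s v.
  by move=> t0; apply: ge_inf; [exists (- s (- h))|exists t].
have lef h r : (forall t, 0 <= t -> r <= s (h + t *: v) - t * s v) ->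
    r <= inf (S h).
  by move=> H; apply: lb_le_inf => // _ [t t0 ->]; exact: H.
have fZ k h : 0 < k -> inf (S (k *: h)) <= k * inf (S h).
  move=> k0; rewrite -ler_pdivrMl//; apply: lef => t t0.
  rewrite ler_pdivrMl//.
  have := Sle (k *: h) (k * t) (mulr_ge0 (ltW k0) t0).
  by rewrite -scalerA -scalerDr (sZ _ _ (ltW k0)) mulrBr mulrA.
exists (fun h => inf (S h)); split.
- split=> [k h|h h'].
    rewrite le_eqVlt => /predU1P[<-|k0].
      rewrite scale0r mul0r; apply/eqP; rewrite eq_le; apply/andP; split.
        by have := Sle 0 0 (lexx _); rewrite scale0r addr0 mul0r subr0 sublinear0.
      by apply: lef => t t0; rewrite add0r sZ// subrr.
    apply/eqP; rewrite eq_le fZ//= -ler_pdivlMl//.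
    have := fZ k^-1 (k *: h); rewrite invr_gt0 => /(_ k0).
    by rewrite scalerA mulVf ?gt_eqF// scale1r.
  rewrite -lerBlDr; apply: (lef) => t t0; rewrite lerBlDr -lerBlDl.
  apply: lef => t' t'0; rewrite lerBlDl.
  apply: le_trans (Sle (h + h') (t + t') (addr_ge0 t0 t'0)) _.
  by have := sD (h + t *: v) (h' + t' *: v); rewrite addrACA -scalerDl; lra.
- by move=> h; have := Sle h 0 (lexx _); rewrite scale0r addr0 mul0r subr0.
- have := Sle (- v) 1 ler01.
  by rewrite scale1r addNr mul1r sublinear0// sub0r.
Qed.

(** Oddness along [v], once obtained, survives further decrease: for [g <= f <= s] one has
    [g (- v) <= f (- v) <= - s v <= - g v]. *)
Lemma sublinear_steps s (vs : seq 'rV[R]_m) : sublinear s ->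
  exists f, [/\ sublinear f, (forall h, f h <= s h) &
    forall v, v \in vs -> f (- v) <= - f v].
Proof.
elim: vs s => [|v vs IH] s ss; first by exists s; split.
have [f [sf fs fv]] := sublinear_step v ss.
have [g [sg gf gvs]] := IH f sf.
exists g; split => // [h|w]; first exact: le_trans (gf h) (fs h).
rewrite inE => /predU1P[->|]; last exact: gvs.
by rewrite (le_trans (gf _))// (le_trans fv)// lerN2 (le_trans (gf v)).
Qed.

(** The initial step in the direction [h0] pins the value there: any sublinear [g] below [f]
    satisfies [g h0 >= - g (- h0) >= s h0]. Steps along the basis then make it linear. *)
Lemma sublinear_support s h0 : sublinear s ->
  exists2 z, (forall h, dot z h <= s h) & dot z h0 = s h0.
Proof.
move=> ss; have [f [sf fs fh0]] := sublinear_step h0 ss.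
have [g [sg gf gE]] := sublinear_steps (codom (fun i => delta_mx 0 i)) sf.
pose z : 'rV[R]_m := \row_i g (delta_mx 0 i).
(* Oddness on basis vectors bounds [g] above by a linear form. A sublinear function below a linear
   one coincides with it, by applying the bound to [- h]. *)
have gz h : g h <= dot z h.
  rewrite {1}(row_sum_delta h) /dot.
  elim/big_ind2 : _ => [|a b x y ab xy|i _].
  - by rewrite (sublinear0 sg).
  - by rewrite (le_trans (sg.2 _ _))// lerD.
  - rewrite mxE mulrC; have [hi|hi] := leP 0 (h 0 i); first by rewrite sg.1.
    have hi0 : 0 <= - h 0 i by rewrite oppr_ge0 ltW.
    rewrite -[X in g (X *: _)]opprK scaleNr -scalerN sg.1//.
    have gEi := gE _ (codom_f (fun i => delta_mx 0 i) i).
    by rewrite (le_trans (ler_wpM2l hi0 gEi))// mulrNN.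
have zg h : dot z h = g h.
  apply/eqP; rewrite eq_le gz andbT -[leLHS]opprK lerNl.
  rewrite (_ : - dot z h = dot z (- h)); last by rewrite !(dotC z) dotNl.
  by rewrite (le_trans _ (gz _))// lerNl sublinear_oppr_ge.
exists z => [h|]; first by rewrite zg (le_trans (gf h)).
apply/eqP; rewrite eq_le zg (le_trans (gf h0))//=.
by rewrite (le_trans _ (sublinear_oppr_ge _ sg))// lerNr (le_trans (gf _)).
Qed.

End sublinear.

(** * Directional derivatives of a bounded convex function *)

Section convex_directional_derivative.
Context {R : realType} {m : nat}.
Variables (psi : 'rV[R]_m -> R) (r C : R).
Hypotheses (r0 : 0 < r) (psi0 : psi 0 = 0)
  (psi_bound : forall h, `|h| <= r -> `|psi h| <= C)
  (psi_convex : forall h h' t, `|h| <= r -> `|h'| <= r -> 0 <= t <= 1 ->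
    psi (t *: h + (1 - t) *: h') <= t * psi h + (1 - t) * psi h').
Implicit Types h : 'rV[R]_m.

(** The oscillation [2 * C] divided by the margin [r / 2]: a Lipschitz constant on the ball of half
    the radius. *)
Let L := 4 * C / r.

Let C0 : 0 <= C.
Proof. by rewrite (le_trans _ (psi_bound (h := 0) _)) ?normr0// ltW. Qed.

Let L0 : 0 <= L.
Proof. by rewrite divr_ge0 ?mulr_ge0// ltW. Qed.

Let r2 : r / 2 <= r. Proof. by move: r0; lra. Qed.

Let lip1 h h' : `|h| <= r / 2 -> `|h'| <= r / 2 ->
  psi h' - psi h <= L * `|h' - h|.
Proof.
move=> hr h'r; have [->|hh'] := eqVneq h' h.
  by rewrite !subrr normr0 mulr0.
pose d := `|h' - h|; have d0 : 0 < d by rewrite normr_gt0 subr_eq0.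
(* The segment is prolonged beyond [h'] by length [r / 2], which stays in the large ball; convexity
   is used with [h'] between [h] and [h'']. *)
pose h'' := h' + (r / 2 / d) *: (h' - h).
have h''r : `|h''| <= r.
  rewrite (le_trans (ler_normD _ _))// normrZ ger0_norm; last first.
    by rewrite !divr_ge0// ltW.
  by rewrite -/d divfK ?gt_eqF// [leRHS]splitr lerD2r.
pose l := d / (d + r / 2).
have dr : 0 < d + r / 2 by rewrite addr_gt0// divr_gt0.
have l01 : 0 <= l <= 1.
  by rewrite (divr_ge0 (ltW d0) (ltW dr)) ler_pdivrMr// mul1r lerDl divr_ge0// ltW.
have E : h' = l *: h'' + (1 - l) *: h.
  rewrite /h'' scalerDr scalerA scalerBr addrA [RHS]addrAC addrAC.
  apply/rowP => i; rewrite !mxE /l.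
  by field; rewrite !gt_eqF//; lra.
have hr' : `|h| <= r := le_trans hr r2.
have := psi_convex h''r hr' l01; rewrite -E.
have := psi_bound h''r; have := psi_bound hr'.
rewrite !ler_norml => /andP[H1 H2] /andP[H3 H4] H5.
have /andP[l0 l1] := l01.
have H6 : psi h' - psi h <= l * (2 * C).
  have : l * (psi h'' - psi h) <= l * (2 * C) by rewrite ler_wpM2l//; lra.
  lra.
rewrite (le_trans H6)// /l mulrAC ler_pdivrMr// -/d /L.
have -> : 4 * C / r * d * (d + r / 2) = d * (2 * C) + 4 * C / r * d ^+ 2.
  by field; rewrite gt_eqF.
by rewrite lerDl mulr_ge0 ?sqr_ge0// divr_ge0 ?mulr_ge0// ltW.
Qed.

Let lip h h' : `|h| <= r / 2 -> `|h'| <= r / 2 ->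
  `|psi h' - psi h| <= L * `|h' - h|.
Proof.
move=> hr h'r; rewrite ler_norml lip1// andbT lerNl opprB distrC.
exact: lip1.
Qed.

Let quotient h := [set psi (t *: h) / t | t in [set t | 0 < t /\ t * `|h| <= r]].

(** By convexity the quotients increase with [t], so this infimum is the limit at [0+]. As an
    infimum it bounds every quotient from below, which later gives half of the uniform convergence
    at once. *)
Definition dirderiv h : R := inf (quotient h).

Let quotient_mono h s t : 0 < s -> s <= t -> t * `|h| <= r ->
  psi (s *: h) / s <= psi (t *: h) / t.
Proof.
move=> s0 st tr; have t0 : 0 < t by exact: lt_le_trans st.
have st01 : 0 <= s / t <= 1 by rewrite (divr_ge0 (ltW s0) (ltW t0)) ler_pdivrMr// mul1r.
have th : `|t *: h| <= r by rewrite normrZ gtr0_norm.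
have z0 : `|0 : 'rV[R]_m| <= r by rewrite normr0 ltW.
have := psi_convex th z0 st01.
rewrite scaler0 addr0 psi0 mulr0 addr0 scalerA divfK ?gt_eqF// => H.
rewrite ler_pdivrMr// (le_trans H)// le_eqVlt; apply/orP; left; apply/eqP; ring.
Qed.

Let small_step h : exists2 t, 0 < t & t * `|h| <= r / 2.
Proof.
exists (r / 2 / (`|h| + 1)).
  by rewrite !divr_gt0// ltr_wpDl.
rewrite mulrAC ler_pdivrMr ?ltr_wpDl// ler_wpM2l//; last by rewrite lerDl.
by rewrite divr_ge0// ltW.
Qed.

(** The Lipschitz bound holds only on the half ball; monotonicity of the quotients carries a lower
    bound at a small step over to larger ones. *)
Let quotient_lb h : lbound (quotient h) (- (L * `|h|)).
Proof.
move=> _ [t [t0 tr] <-].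
have [s s0 sr] := small_step h.
pose u := Num.min s t; have u0 : 0 < u by rewrite lt_min s0.
have ut : u <= t by rewrite ge_min lexx orbT.
have us : u <= s by rewrite ge_min lexx.
apply: le_trans (quotient_mono u0 ut tr).
have ur : `|u *: h| <= r / 2.
  by rewrite normrZ gtr0_norm// (le_trans _ sr)// ler_wpM2r.
have z0 : `|0 : 'rV[R]_m| <= r / 2 by rewrite normr0 divr_ge0// ltW.
have := lip z0 ur; rewrite psi0 !subr0 normrZ gtr0_norm// ler_norml => /andP[H _].
by rewrite ler_pdivlMr// mulNr (mulrC _ u) mulrCA.
Qed.

Let quotient_nonempty h : quotient h !=set0.
Proof.
have [s s0 sr] := small_step h; exists (psi (s *: h) / s), s => //; split=> //.
exact: le_trans sr r2.
Qed.

Lemma dirderiv_le h t : 0 < t -> t * `|h| <= r -> dirderiv h <= psi (t *: h) / t.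
Proof.
move=> t0 tr; apply: ge_inf; last by exists t.
by exists (- (L * `|h|)); exact: quotient_lb.
Qed.

Lemma dirderiv_ge h k :
  (forall t, 0 < t -> t * `|h| <= r -> k <= psi (t *: h) / t) ->
  k <= dirderiv h.
Proof.
move=> H; apply: lb_le_inf; first exact: quotient_nonempty.
by move=> _ [t [t0 tr] <-]; exact: H.
Qed.

Lemma dirderiv_near h e : 0 < e -> exists2 d, 0 < d &
  forall t, 0 < t <= d -> psi (t *: h) / t <= dirderiv h + e.
Proof.
move=> e0; have [|_ [d [d0 dr] <-] dE] := @inf_adherent R (quotient h) _ e0.
  by split; [exact: quotient_nonempty|exists (- (L * `|h|)); exact: quotient_lb].
exists d => // t /andP[t0 td].
by rewrite (le_trans (quotient_mono t0 td dr))// ltW.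
Qed.

Let dirderivZ_le h k : 0 < k -> k * dirderiv h <= dirderiv (k *: h).
Proof.
move=> k0; apply: dirderiv_ge => t t0; rewrite normrZ gtr0_norm// mulrA => tr.
rewrite -ler_pdivlMl// (le_trans (dirderiv_le _ tr)) ?mulr_gt0//.
rewrite scalerA invfM (mulrC k^-1) mulrA mulrC.
by [].
Qed.

Lemma dirderiv_sublinear : sublinear dirderiv.
Proof.
split=> [k h|h h'].
  rewrite le_eqVlt => /predU1P[<-|k0].
    rewrite scale0r mul0r; apply/eqP; rewrite eq_le; apply/andP; split.
      have := @dirderiv_le 0 1; rewrite normr0 mulr0 scaler0 psi0 mul0r.
      by apply=> //; exact: ltW.
    by apply: dirderiv_ge => t _ _; rewrite scaler0 psi0 mul0r.
  apply/eqP; rewrite eq_le dirderivZ_le// andbT -ler_pdivrMl//.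
  have := @dirderivZ_le (k *: h) k^-1; rewrite invr_gt0 => /(_ k0).
  by rewrite scalerA mulVf ?gt_eqF// scale1r.
apply/ler_addgt0Pr => e e0.
have e20 : 0 < e / 2 by rewrite divr_gt0.
have [d d0 dE] := dirderiv_near h e20.
have [d' d'0 dE'] := dirderiv_near h' e20.
have [s s0 sr] := small_step h.
have [s' s'0 sr'] := small_step h'.
(* A common step for both directions. The sum is tested at [t / 2], where it is the midpoint of
   [t *: h] and [t *: h']. *)
pose t := Num.min (Num.min d d') (Num.min s s').
have t0 : 0 < t by rewrite !lt_min d0 d'0 s0 s'0.
have td : 0 < t <= d by rewrite t0 !ge_min lexx.
have td' : 0 < t <= d' by rewrite t0 !ge_min lexx !orbT.
have ts : `|t *: h| <= r / 2.
  by rewrite normrZ gtr0_norm// (le_trans _ sr)// ler_wpM2r// !ge_min lexx !orbT.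
have ts' : `|t *: h'| <= r / 2.
  by rewrite normrZ gtr0_norm// (le_trans _ sr')// ler_wpM2r// !ge_min lexx !orbT.
have t20 : 0 < t / 2 by rewrite divr_gt0.

have thh : t / 2 * `|h + h'| <= r.
  rewrite mulrAC ler_pdivrMr//.
  have : t * `|h + h'| <= t * (`|h| + `|h'|) by rewrite (ler_wpM2l (ltW t0))// ler_normD.
  move: ts ts'; rewrite !normrZ gtr0_norm// mulrDr => K1 K2 K3.
  apply: le_trans K3 (le_trans (lerD K1 K2) _); move: r0; lra.
rewrite (le_trans (dirderiv_le t20 thh))//.
have half01 : 0 <= (2^-1 : R) <= 1 by rewrite invr_ge0 ler0n invf_le1// ler1n.
have := psi_convex (le_trans ts r2) (le_trans ts' r2) half01.
have -> : 2^-1 *: (t *: h) + (1 - 2^-1) *: (t *: h') = (t / 2) *: (h + h').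
  by apply/rowP => i; rewrite !mxE; field.
move=> H; have := dE _ td; have := dE' _ td'.
rewrite !ler_pdivrMr// => H1 H2; lra.
Qed.

Lemma dirderiv_lipschitz h h' : `|dirderiv h' - dirderiv h| <= L * `|h' - h|.
Proof.
have ss := dirderiv_sublinear.
have H k : dirderiv k <= L * `|k|.
  have [s s0 sr] := small_step k.
  
  rewrite (le_trans (dirderiv_le s0 (le_trans sr r2)))// ler_pdivrMr//.
  have sr' : `|s *: k| <= r / 2 by rewrite normrZ gtr0_norm.
  have z0 : `|0 : 'rV[R]_m| <= r / 2 by rewrite normr0 divr_ge0// ltW.
  have := lip1 z0 sr'; rewrite psi0 !subr0 normrZ gtr0_norm//.
  by rewrite mulrCA [X in _ <= X]mulrC.
have K k k' : dirderiv k' - dirderiv k <= L * `|k' - k|.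
  rewrite lerBlDl (le_trans _ (lerD (lexx _) (H _)))//.
  by have := ss.2 k (k' - k); rewrite subrKC.
by rewrite ler_norml K andbT lerNl opprB distrC K.
Qed.

Lemma dirderiv_continuous : continuous dirderiv.
Proof.
suff H h : dirderiv @ nbhs h --> dirderiv h by exact: H.
apply/cvgrPdist_le => e e0.
have L10 : 0 < L + 1 by rewrite ltr_wpDl.
near=> h'.
rewrite distrC (le_trans (dirderiv_lipschitz _ _))//.
apply: (@le_trans _ _ ((L + 1) * `|h' - h|)).
  by rewrite ler_wpM2r// lerDl.
rewrite -ler_pdivlMl// distrC; near: h'.
by apply: (@cvgr_dist_le _ _ _ (nbhs h) _ id h); [exact: cvg_id|rewrite mulr_gt0// invr_gt0].
Unshelve. all: by end_near. Qed.

(** The upper bound is local by monotonicity in the step and the Lipschitz estimates, and becomes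
    uniform by compactness. The lower bound is the infimum property and only asks that the step keep
    the point in the ball. *)
Lemma dirderiv_uniform K e : 0 < e -> \forall n \near \oo, forall h, `|h| <= K ->
  `|Num.sqrt n%:R * psi ((Num.sqrt n%:R)^-1 *: h) - dirderiv h| <= e.
Proof.
move=> e0.
have e30 : 0 < e / 3 by rewrite divr_gt0.
have /compact_near_coveringP := @norm_ball_compact R m K.
move=> /(_ nat \oo (fun n h =>
  Num.sqrt n%:R * psi ((Num.sqrt n%:R)^-1 *: h) <= dirderiv h + e) _).
have sq0 := @cvg_sqrtnV0 R.
have near_sq (d : R) : 0 < d -> \forall n \near \oo, 0 < (Num.sqrt n%:R : R)^-1 <= d.
  move=> d0; near=> n.
  have n0 : (0 < n)%N by near: n; exact: nbhs_infty_gt.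
  rewrite invr_gt0 sqrtr_gt0 ltr0n n0/=.
  rewrite -[leLHS]ger0_norm ?invr_ge0 ?sqrtr_ge0//; near: n.
  exact: (cvgr0_norm_le _ sq0).
have H h : `|h| <= K -> \forall h' \near h & n \near \oo,
   Num.sqrt n%:R * psi ((Num.sqrt n%:R)^-1 *: h') <= dirderiv h' + e.
  move=> _.
  have [d d0 dE] := dirderiv_near h e30.
  have L10 : 0 < L + 1 by rewrite ltr_wpDl.
  (* One third of [e] for the quotient at the centre [h], one for moving [psi] from [h] to [h'], one
     for moving [dirderiv]. *)
  pose rho := e / 3 / (L + 1).
  have rho0 : 0 < rho by rewrite divr_gt0.
  pose d1 := Num.min d (r / 2 / (`|h| + rho)).
  have d10 : 0 < d1 by rewrite lt_min d0 !divr_gt0// ltr_wpDl.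
  exists (ball h rho, [set n | 0 < (Num.sqrt n%:R : R)^-1 <= d1]) => /=.
    by split; [exact: nbhsx_ballx|exact: near_sq].
  case=> h' n /=; rewrite -ball_normE/= => -[hh' /andP[s0 sd1]].
  set s := (Num.sqrt n%:R)^-1 in s0 sd1 *.
  have sV : Num.sqrt n%:R = s^-1 :> R by rewrite invrK.
  rewrite sV mulrC.
  have sd : 0 < s <= d by rewrite s0 (le_trans sd1)// ge_min lexx.
  have shr : s * (`|h| + rho) <= r / 2.
    by rewrite -ler_pdivlMr ?ltr_wpDl// (le_trans sd1)// ge_min lexx orbT.
  have nh : `|s *: h| <= r / 2.
    by rewrite normrZ gtr0_norm// (le_trans _ shr)// (ler_wpM2l (ltW s0))// lerDl ltW.
  have nh' : `|s *: h'| <= r / 2.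
    rewrite normrZ gtr0_norm// (le_trans _ shr)// (ler_wpM2l (ltW s0))//.
    rewrite -[h'](subrK h) (le_trans (ler_normD _ _))// addrC lerD2l.
    by rewrite distrC ltW.
  have H1 := dE _ sd.
  have H2 : psi (s *: h') / s <= psi (s *: h) / s + L * `|h' - h|.
    rewrite ler_pdivrMr// mulrDl divfK ?gt_eqF// -lerBlDl.
    rewrite (le_trans (lip1 nh nh'))// -scalerBr normrZ gtr0_norm//.
    rewrite le_eqVlt; apply/orP; left; apply/eqP; ring.
  have H3 := dirderiv_lipschitz h' h.
  have H4 : L * `|h' - h| <= e / 3.
    apply: (@le_trans _ _ ((L + 1) * `|h' - h|)).
      by rewrite ler_wpM2r// lerDl.
    by rewrite -ler_pdivlMl// distrC mulrC ltW.
  move: H3; rewrite ler_norml distrC => /andP[H3 H3'].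
  lra.
move=> /(_ H) {}H.
near=> n; move=> h hK.
have n0 : (0 < n)%N by near: n; exact: nbhs_infty_gt.
have s0 : 0 < (Num.sqrt n%:R : R)^-1 by rewrite invr_gt0 sqrtr_gt0 ltr0n.
have up : Num.sqrt n%:R * psi ((Num.sqrt n%:R)^-1 *: h) <= dirderiv h + e.
  by have : `|h| <= K by []; move: h {hK}; near: n.
have lo : dirderiv h <= Num.sqrt n%:R * psi ((Num.sqrt n%:R)^-1 *: h).
  rewrite -[X in X * _]invrK mulrC; apply: dirderiv_le => //.
  have hK1 : `|h| <= `|K| + 1.
    by rewrite (le_trans hK)// (le_trans (ler_norm K))// lerDl.
  rewrite (le_trans (ler_wpM2l (ltW s0) hK1))// -ler_pdivlMr ?ltr_wpDl//.
  have : 0 < (Num.sqrt n%:R : R)^-1 <= r / (`|K| + 1).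
    by near: n; apply: near_sq; rewrite divr_gt0// ltr_wpDl.
  by case/andP.
by rewrite ger0_norm ?subr_ge0// lerBlDl.
Unshelve. all: by end_near. Qed.

End convex_directional_derivative.

(** * Subgradients at an interior point of the simplex *)

Section simplex.
Context {R : realType} {m : nat}.
Implicit Types p q h z : 'rV[R]_m.

Definition simplex q := (forall i, 0 <= q 0 i) /\ \sum_i q 0 i = 1.

Definition subgradient (phi : 'rV[R]_m -> R) p z :=
  forall q, simplex q -> phi p + dot z (q - p) <= phi q.

Variables (phi : 'rV[R]_m -> R) (p : 'rV[R]_m) (C : R).
Hypotheses (p_gt0 : forall i, 0 < p 0 i) (p1 : \sum_i p 0 i = 1)
  (phi_bound : forall q, simplex q -> 0 <= phi q <= C)
  (phi_convex : forall q q' t, simplex q -> simplex q' -> 0 <= t <= 1 ->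
    phi (t *: q + (1 - t) *: q') <= t * phi q + (1 - t) * phi q').

Let total h := \sum_i h 0 i.
(** Projection along [p] onto the directions of total mass 0. It turns [phi], controlled only on the
    simplex, into a function that is convex on a full ball. *)
Let proj h := h - total h *: p.
Let psi h := phi (p + proj h) - phi p.
(** The product is a positive lower bound for every coordinate of [p]. A coordinate of [proj h] is
    at most [r + m * r] in absolute value, whence the division by [m.+1]. *)
Let r := (\prod_i p 0 i) / (m.+1)%:R.

Let simplex_p : simplex p.
Proof. by split => // i; exact: ltW. Qed.

Let r0 : 0 < r.
Proof. by rewrite divr_gt0// prodr_gt0. Qed.

Let p_le1 i : p 0 i <= 1.
Proof. by rewrite -p1 (bigD1 i)//= lerDl sumr_ge0// => j _; exact: ltW. Qed.

Let prod_le i : \prod_j p 0 j <= p 0 i.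
Proof.
rewrite (bigD1 i)//= ler_piMr//; first exact: ltW.
by apply: prodr_ile1 => j _; rewrite p_le1 ltW.
Qed.

Let totalD h h' : total (h + h') = total h + total h'.
Proof. by rewrite /total -big_split; apply: eq_bigr => i _; rewrite mxE. Qed.

Let totalZ k h : total (k *: h) = k * total h.
Proof. by rewrite /total mulr_sumr; apply: eq_bigr => i _; rewrite mxE. Qed.

Let projD h h' : proj (h + h') = proj h + proj h'.
Proof. by rewrite /proj totalD scalerDl opprD addrACA. Qed.

Let projZ k h : proj (k *: h) = k *: proj h.
Proof. by rewrite /proj totalZ scalerBr scalerA. Qed.

Let proj_id h : total h = 0 -> proj h = h.
Proof. by move=> h0; rewrite /proj h0 scale0r subr0. Qed.

Let total_norm h : `|total h| <= m%:R * `|h|.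
Proof.
rewrite (le_trans (ler_norm_sum _ _ _))// mulr_natl.
rewrite -[X in _ *+ X](card_ord m) -sumr_const.
by apply: ler_sum => i _; exact: coord_le_norm.
Qed.

Let simplex_proj h : `|h| <= r -> simplex (p + proj h).
Proof.
move=> hr; split=> [i|]; last first.
  rewrite -/(total _) totalD /proj -scaleNr totalD totalZ /total p1.
  by rewrite mulr1 subrr addr0.
rewrite !mxE.
have H1 : `|h 0 i| <= r := le_trans (coord_le_norm _ _) hr.
have H2 : `|total h| <= m%:R * r := le_trans (total_norm h) (ler_wpM2l (ler0n _ _) hr).
have H3 : `|total h * p 0 i| <= m%:R * r.
  by rewrite normrM (le_trans _ H2)// ler_piMr// gtr0_norm// p_le1.
have H4 : r + m%:R * r <= p 0 i.
  have -> : r + m%:R * r = r * m.+1%:R by rewrite -natr1; ring.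
  by rewrite /r divfK ?prod_le// pnatr_eq0.
move: H1 H3; rewrite !ler_norml => /andP[H1 _] /andP[_ H3]; lra.
Qed.

Let psi0 : psi 0 = 0.
Proof. by rewrite /psi -(scale0r 0) projZ scale0r addr0 subrr. Qed.

Let psi_bound h : `|h| <= r -> `|psi h| <= C.
Proof.
move=> /simplex_proj/phi_bound/andP[H1 H2].
have /andP[H3 H4] := phi_bound simplex_p.
rewrite ler_norml /psi; apply/andP; split; lra.
Qed.

Let psi_convex h h' t : `|h| <= r -> `|h'| <= r -> 0 <= t <= 1 ->
  psi (t *: h + (1 - t) *: h') <= t * psi h + (1 - t) * psi h'.
Proof.
move=> /simplex_proj H1 /simplex_proj H2 t01.
have := phi_convex H1 H2 t01.
have -> : t *: (p + proj h) + (1 - t) *: (p + proj h') =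
    p + proj (t *: h + (1 - t) *: h').
  rewrite projD !projZ !scalerDr addrACA -scalerDl subrKC scale1r//.
rewrite /psi; lra.
Qed.

Let D := dirderiv psi r.

(** In directions of total mass 0 the last two clauses say that [D h] is the maximum of [z . h] over
    the subgradients. Continuity holds on all row vectors, since [D] is built on the projected
    function. *)
Lemma simplex_directional_derivative : exists D : 'rV[R]_m -> R,
  [/\ continuous D,
      forall K e, 0 < e -> \forall n \near \oo, forall h, `|h| <= K ->
        \sum_i h 0 i = 0 ->
        `|Num.sqrt n%:R * (phi (p + (Num.sqrt n%:R)^-1 *: h) - phi p) - D h| <= e,
      forall h, \sum_i h 0 i = 0 ->
        exists2 z, subgradient phi p z & dot z h = D h &
      forall z h, subgradient phi p z -> \sum_i h 0 i = 0 -> dot z h <= D h].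
Proof.
exists D; split.
- exact: (dirderiv_continuous r0 psi0 psi_bound psi_convex).
- move=> K e e0; have := dirderiv_uniform r0 psi0 psi_bound psi_convex K e0.
  apply: filterS => n H h hK h0; have := H h hK.
  by rewrite /psi projZ proj_id.
- move=> h0 _.
  have [z zD zh0] := sublinear_support h0 (dirderiv_sublinear r0 psi0 psi_bound psi_convex).
  exists z => // q qs.
  pose h := q - p.
  have th : total h = 0.
    by rewrite /h -scaleN1r totalD totalZ /total p1 qs.2 mulN1r subrr.
  (* The derivative controls [phi] only near [p]; convexity along the segment from [p] to [q]
     extends the subgradient inequality to the whole simplex. *)
  pose t := Num.min 1 (r / (`|h| + 1)).
  have t0 : 0 < t by rewrite lt_min ltr01 divr_gt0// ltr_wpDl.
  have t1 : t <= 1 by rewrite ge_min lexx.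
  have tr : t * `|h| <= r.
    rewrite (@le_trans _ _ (t * (`|h| + 1)))//; first by rewrite ler_wpM2l ?lerDl// ltW.
    by rewrite -ler_pdivlMr ?ltr_wpDl// ge_min lexx orbT.
  have := le_trans (zD h) (dirderiv_le r0 psi0 psi_bound psi_convex t0 tr).
  rewrite ler_pdivlMr// /psi projZ proj_id// => H.
  have t01 : 0 <= t <= 1 by rewrite t1 ltW.
  have := phi_convex qs simplex_p t01.
  have -> : t *: q + (1 - t) *: p = p + t *: h.
    by rewrite /h scalerBr scalerBl scale1r addrA addrAC addrC addrA.
  move=> H'.
  have H'' : dot z h * t <= t * (phi q - phi p) by lra.
  by move: H''; rewrite mulrC ler_pM2l// /h; lra.
- move=> z h zs h0; apply: (dirderiv_ge r0) => t t0 tr.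
  rewrite ler_pdivlMr// /psi projZ proj_id//.
  have ts : `|t *: h| <= r by rewrite normrZ gtr0_norm.
  have := zs _ (simplex_proj ts); rewrite projZ proj_id// addrAC subrr add0r.
  rewrite (dotC z) dotZl (dotC h); lra.
Qed.

End simplex.

(** * Semidiscrete optimal transport *)

Section measure_preliminaries.
Context {R : realType}.

Lemma continuous_measurable_borel (S T : ptopologicalType) (f : S -> T) :
  continuous f -> measurable_fun setT (f : borel S -> borel T).
Proof.
move=> /continuousP fc; apply: measurability => //.
move=> _ [B oB <-]; rewrite setTI.
by apply: sub_sigma_algebra; exact: fc.
Qed.

Lemma continuous_measurable_real (S : ptopologicalType) (f : S -> R) :
  continuous f -> measurable_fun setT (f : borel S -> R).
Proof.
move=> /continuousP fc; apply: (measurability _ (RGenOpens.measurableE R)).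
move=> _ [_ [a [b ->] <-]]; rewrite setTI.
by apply: sub_sigma_algebra; apply: fc; exact: interval_open.
Qed.

Lemma polish_measurable1 (X : ptopologicalType) (x : borel X) :
  polish R X -> measurable [set x].
Proof.
move=> [[dist [dist0 distC tri distN _]] _].
rewrite -[X in measurable X]setCK; apply: measurableC.
apply: sub_sigma_algebra; rewrite openE => y /= yx; apply/distN.
exists (dist y x); last by move=> z /= + zx; rewrite zx ltxx.
rewrite lt_neqAle eq_sym; apply/andP; split; first by apply/eqP => /dist0.
have := tri x y x; rewrite (distC x y) (dist0 x x).2//; lra.
Qed.

Lemma measurable_fun_glue d d' (T : measurableType d) (T' : measurableType d')
    (I : finType) (A : I -> set T) (g_ : I -> T -> T') (g : T -> T') :
  (forall i, measurable (A i)) -> (forall y, exists i, A i y) ->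
  (forall i, measurable_fun setT (g_ i)) ->
  (forall i y, A i y -> g y = g_ i y) -> measurable_fun setT g.
Proof.
move=> mA cA mg gE _ B mB; rewrite setTI.
have -> : g @^-1` B = \bigcup_(i in [set: I]) (A i `&` g_ i @^-1` B).
  apply/seteqP; split => [y By|y [i _ [Ay By]]]; last by rewrite /preimage/= (gE i).
  have [i Ay] := cA y; exists i => //; split => //.
  by rewrite /preimage/= -(gE i).
apply: fin_bigcup_measurable => // i _; apply: measurableI => //.
by rewrite -[X in measurable X]setTI; exact: mg.
Qed.

Lemma probability_pushforward d d' (T : measurableType d)
    (T' : measurableType d') (P : probability T R) (f : T -> T') :
  measurable_fun setT f -> exists Q : probability T' R,
    (forall A, Q A = P (f @^-1` A)) /\
    forall g, measurable_fun setT g -> (forall y, 0 <= g y)%E ->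
      (\int[Q]_y g y = \int[P]_x g (f x))%E.
Proof.
move=> mf; pose X : {RV P >-> T'} := HB.pack f (isMeasurableFun.Build _ _ _ _ f mf).
exists (distribution P X); split => // g mg g0.
by rewrite /distribution ge0_integral_pushforward.
Qed.

Lemma integral_image d d' (T : measurableType d) (T' : measurableType d')
    (P : probability T R) (Q : probability T' R) (h : T -> T') (g : T' -> R) :
  measurable_fun setT h ->
  (forall B, measurable B -> P (h @^-1` B) = Q B) ->
  Q.-integrable setT (EFin \o g) ->
  P.-integrable setT (EFin \o (g \o h)) /\
  (\int[P]_x (g (h x))%:E = \int[Q]_y (g y)%:E)%E.
Proof.
move=> mh PQ ig; pose h' : {RV P >-> T'} := HB.pack h (isMeasurableFun.Build _ _ _ _ h mh).
have mg : measurable_fun setT g by have /integrableP[/measurable_EFinP] := ig.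
have gh : P.-integrable setT (EFin \o (g \o h)).
  apply/integrableP; split.
    by apply/measurable_EFinP; exact: measurableT_comp.
  have /integrableP[_] := ig; apply: le_lt_trans; rewrite le_eqVlt; apply/orP; left; apply/eqP.
  rewrite -(@eq_measure_integral _ _ _ _ Q (distribution P h')); last first.
    by move=> B mB _; exact: PQ.
  rewrite ge0_integral_pushforward//.
  by apply: measurableT_comp => //; exact/measurable_EFinP.
split => //.
rewrite -(@eq_measure_integral _ _ _ _ Q (distribution P h')); last first.
  by move=> B mB _; exact: PQ.
by rewrite (integral_pushforward mh)//; exact/measurable_EFinP.
Qed.

End measure_preliminaries.

Section mixture.
Context {R : realType} {d : measure_display} {T : measurableType d} {m : nat}.
Variables (w : 'I_m.+1 -> R) (P : 'I_m.+1 -> probability T R).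
Hypotheses (w0 : forall i, 0 <= w i) (w1 : \sum_i w i = 1).

(** [msum] runs over naturals, hence the conversion of the index by [inord]. *)
Definition mixture : set T -> \bar R :=
  msum (fun k => mscale (NngNum (w0 (inord k))) (P (inord k))) m.+1.

HB.instance Definition _ := Measure.on mixture.

Lemma mixtureE A : mixture A = (\sum_i (w i)%:E * P i A)%E.
Proof.
by rewrite /mixture /msum; apply: eq_bigr => i _; rewrite /mscale/= inord_val.
Qed.

Let mixtureT : mixture setT = 1%E.
Proof.
rewrite mixtureE; under eq_bigr do rewrite probability_setT mule1.
by rewrite sumEFin w1.
Qed.

HB.instance Definition _ := Measure_isProbability.Build _ _ _ mixture mixtureT.

Lemma probability_mixture : exists Q : probability T R,
  (forall A, Q A = \sum_i (w i)%:E * P i A)%E /\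
  forall g, measurable_fun setT g -> (forall y, 0 <= g y)%E ->
    (\int[Q]_y g y = \sum_i (w i)%:E * \int[P i]_x g x)%E.
Proof.
exists mixture; split => [A|g mg g0]; first exact: mixtureE.
rewrite ge0_integral_measure_sum//; apply: eq_bigr => i _.
by rewrite ge0_integral_mscale//= inord_val.
Qed.

End mixture.

(** * Semidiscrete plans, duality and convexity of the cost *)

Section semidiscrete.
Context {R : realType} {X Y : ptopologicalType} {m : nat}.
Variables (polX : polish R X) (x : 'I_m.+1 -> X) (x_inj : injective x).
Variables (Q : probability (borel Y) R) (c : X * Y -> R).
Hypotheses (c_ge0 : forall xy, 0 <= c xy) (c_cont : continuous c)
  (c_int : forall i, (\int[Q]_y (c (x i, y))%:E < +oo)%E).
Implicit Types q z : 'rV[R]_m.+1.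

(** Describing the first marginal by its weights makes the cost a function of a row vector; the
    empirical measure and [P] are both reduced to it by [transport_costE]. *)
Definition plans q : set (probability (borel (X * Y)%type) R) :=
  [set pi | (forall A : set (borel X), measurable A ->
      pi (A `*` setT) = \sum_k (q 0 k)%:E * \d_(x k : borel X) A)%E /\
    (forall B : set (borel Y), measurable B -> pi (setT `*` B) = Q B)].

Definition optimal_cost q : \bar R :=
  ereal_inf [set \int[pi]_xy (c xy)%:E | pi in plans q]%E.

Lemma transport_costE (mu : {measure set (borel X) -> \bar R}) q :
  (forall A : set (borel X), measurable A ->
     mu A = \sum_k (q 0 k)%:E * \d_(x k : borel X) A)%E ->
  transport_cost c mu Q = optimal_cost q.
Proof.
move=> muE; rewrite /transport_cost /optimal_cost; congr (ereal_inf (image _ _)).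
apply/seteqP; split => pi [H1 H2]; split => // A mA; first by rewrite H1// muE.
by rewrite H1// muE.
Qed.

Let mc : measurable_fun setT (c : borel (X * Y)%type -> R).
Proof. exact: continuous_measurable_real. Qed.

Let embed i y : X * Y := (x i, y).

Let embed_cont i : continuous (embed i).
Proof. by move=> y; apply: cvg_pair => /=; [exact: cvg_cst|exact: cvg_id]. Qed.

Let membed i : measurable_fun setT (embed i : borel Y -> borel (X * Y)%type).
Proof. exact: continuous_measurable_borel. Qed.

Let mfst : measurable_fun setT (fst : borel (X * Y)%type -> borel X).
Proof. by apply: continuous_measurable_borel => -[u v]; exact: cvg_fst. Qed.

Let msnd : measurable_fun setT (snd : borel (X * Y)%type -> borel Y).
Proof. by apply: continuous_measurable_borel => -[u v]; exact: cvg_snd. Qed.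

Let f (i : 'I_m.+1) (y : borel Y) : R := c (x i, y).

Let mf i : measurable_fun setT (f i : borel Y -> R).
Proof. by apply: measurableT_comp (membed i); exact: mc. Qed.

Let f_int i : Q.-integrable setT (EFin \o (f i : borel Y -> R)).
Proof.
apply/integrableP; split; first exact/measurable_EFinP.
rewrite (eq_integral (fun y : borel Y => (f i y)%:E)) => [|y _]; first exact: c_int.
by rewrite /= ger0_norm// c_ge0.
Qed.

(* Ties in the minimum are broken by the smallest index. *)
Let cell z (i : 'I_m.+1) : set (borel Y) := [set y | forall j : 'I_m.+1,
  if (j < i)%N then f i y - z 0 i < f j y - z 0 j
  else f i y - z 0 i <= f j y - z 0 j].

Let mcell z i : measurable (cell z i).
Proof.
have mh k : measurable_fun setT (fun y : borel Y => f k y - z 0 k).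
  by apply: measurable_funB.
rewrite (_ : cell z i = \bigcap_(j in [set: 'I_m.+1])
    ((fun y => if (j < i)%N then f i y - z 0 i < f j y - z 0 j
      else f i y - z 0 i <= f j y - z 0 j) @^-1` [set true])); last first.
  apply/seteqP; split => [y H j _|y H j]; first by have := H j; rewrite /preimage/=; case: ifP.
  by have := H j Logic.I; rewrite /preimage/=; case: ifP.
apply: fin_bigcap_measurable => // j _.
rewrite -[X in measurable X]setTI; case: (j < i)%N.
  by apply: measurable_fun_ltr.
by apply: measurable_fun_ler.
Qed.

Let cell_cover z y : exists i, cell z i y.
Proof.
pose h i := f i y - z 0 i.
pose P i := [forall j, h i <= h j].
have [i1 Pi1] : exists i, P i.
  have [i _ Hi] := @arg_minP _ R _ (ord0 : 'I_m.+1) xpredT h isT.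
  by exists i; apply/forallP => j; exact: Hi.
have [i Pi Hi] := @arg_minnP _ i1 P (fun i => i : nat) Pi1.
exists i => j; case: ifPn => ji; last exact: (forallP Pi).
rewrite ltNge; apply/negP => hji.
have : P j by apply/forallP => k; apply: le_trans hji _; exact: (forallP Pi).
by move=> /Hi; rewrite leqNgt ji.
Qed.

Let cell_uniq z y i j : cell z i y -> cell z j y -> i = j.
Proof.
move=> Hi Hj; apply/val_inj; case: (ltngtP i j) => //= ij.
- have := Hj i; rewrite ij => H; have := Hi j.
  by rewrite ltnNge (ltnW ij)/= leNgt H.
- have := Hi j; rewrite ij => H; have := Hj i.
  by rewrite ltnNge (ltnW ij)/= leNgt H.
Qed.

Let sel z y : 'I_m.+1 := projT1 (cid (cell_cover z y)).

Let cell_sel z y : cell z (sel z y) y.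
Proof. by rewrite /sel; case: cid. Qed.

Let selE z i y : cell z i y -> sel z y = i.
Proof. by move=> H; apply: cell_uniq H; exact: cell_sel. Qed.

Let sel_min z y j : f (sel z y) y - z 0 (sel z y) <= f j y - z 0 j.
Proof. by have := cell_sel z y j; case: ifP => // _; exact: ltW. Qed.

Let mselect z : measurable_fun setT
  (fun y => (x (sel z y), y) : borel (X * Y)%type).
Proof.
apply: (measurable_fun_glue (mcell z) (cell_cover z) membed).
by move=> i y /selE ->.
Qed.

Let cmin z (y : borel Y) : R := f (sel z y) y - z 0 (sel z y).

Let mcmin z : measurable_fun setT (cmin z).
Proof.
apply: (measurable_fun_glue (g_ := fun i (y : borel Y) => f i y - z 0 i) (mcell z) (cell_cover z)).
  by move=> i; exact: measurable_funB.
by move=> i y /selE H; rewrite /cmin H.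
Qed.

Let cmin_big z y : \big[mine/+oo%E]_(i < m.+1) (c (x i, y) - z 0 i)%:E = (cmin z y)%:E.
Proof.
apply/eqP; rewrite eq_le; apply/andP; split.
  exact: (bigmin_le_cond _ (fun i => (f i y - z 0 i)%:E)).
apply/bigmin_geP; split => [|i _]; first exact: leey.
by rewrite lee_fin; exact: sel_min.
Qed.

Let znorm z := \sum_i `|z 0 i|.

Let znorm_ge z i : `|z 0 i| <= znorm z.
Proof. by rewrite /znorm (bigD1 i)//= lerDl sumr_ge0. Qed.

Let cmin_lb z y : - znorm z <= cmin z y.
Proof.
have := znorm_ge z (sel z y); rewrite ler_norml => /andP[_ H].
have := c_ge0 (x (sel z y), y); rewrite /cmin /f; lra.
Qed.

Let cmin_int z : Q.-integrable setT (EFin \o cmin z).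
Proof.
apply: (@le_integrable _ _ _ _ _ _ _ (fun y => \sum_i (f i y)%:E + (znorm z)%:E)%E) => //.
- exact/measurable_EFinP.
- move=> y _ /=; rewrite sumEFin -EFinD lee_fin [leRHS]ger0_norm; last first.
    by rewrite addr_ge0 ?sumr_ge0// => i _; exact: c_ge0.
  rewrite (le_trans (ler_normB _ _))// lerD//.
  rewrite ger0_norm ?c_ge0// (bigD1 (sel z y))//= lerDl sumr_ge0// => j _.
  exact: c_ge0.
- apply: integrableD => //; first by apply: integrable_sum => // i _; exact: f_int.
  apply: (bounded_integrable Q (f := fun=> znorm z)) => //.
  by exists `|znorm z|.
Qed.

(** [- Mmin z] is the convex conjugate at [z] of the optimal cost on the simplex: [weak_duality]
    gives one inequality, [sel_plan] attains it. *)
Let Mmin z : R := fine (\int[Q]_y (cmin z y)%:E)%E.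

Let MminE z : (\int[Q]_y (cmin z y)%:E = (Mmin z)%:E)%E.
Proof. by rewrite fineK//; exact: integrable_fin_num (cmin_int z). Qed.

Lemma dual_objE z p : simplex p ->
  dual_obj c x Q z p = (dot z p + Mmin z)%:E.
Proof.
move=> [p0 p1]; rewrite /dual_obj EFinD; congr (_ + _)%E.
  have pE i : `|p 0 i| = p 0 i by rewrite ger0_norm.
  under eq_bigr do rewrite pE; rewrite p1 invr1 mul1r; congr (_%:E).
  by apply: eq_bigr => i _; rewrite pE mulrC.
by rewrite -MminE; apply: eq_integral => y _; exact: cmin_big.
Qed.

Let sel_expectation z (g : 'I_m.+1 -> R) :
  (\int[Q]_y (g (sel z y))%:E = \sum_i (g i)%:E * Q (cell z i))%E.
Proof.
rewrite (eq_integral (fun y => \sum_i (g i)%:E * (\1_(cell z i) y)%:E)%E); last first.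
  move=> y _; rewrite (bigD1 (sel z y))//= indicE mem_set ?mule1; last exact: cell_sel.
  rewrite big1 ?adde0// => i; rewrite indicE => ni.
  by rewrite memNset ?mule0// => /selE E; move: ni; rewrite E eqxx.
rewrite integral_sum//; last first.
  by move=> i; apply: integrableZl => //; exact: integrable_indic.
apply: eq_bigr => i _; rewrite integralZl//; last exact: integrable_indic.
by rewrite integral_indic// setIT.
Qed.

Let sel_weight z : 'rV[R]_m.+1 := \row_i fine (Q (cell z i)).

Let sel_weightE z i : Q (cell z i) = (sel_weight z 0 i)%:E.
Proof. by rewrite mxE fineK// fin_num_measure. Qed.

Let simplex_sel_weight z : simplex (sel_weight z).
Proof.
split=> [i|]; first by rewrite mxE fine_ge0.
apply: EFin_inj; rewrite -sumEFin.
have := sel_expectation z (fun=> 1); rewrite integral_cst//= mul1e.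
rewrite (@probability_setT _ _ _ Q) => ->.
by apply: eq_bigr => i _; rewrite mul1e sel_weightE.
Qed.

(** Sending each [y] to its selected atom costs [cmin z y] plus the potential of that atom. The
    first marginal is then whatever weight the cells receive. *)
Let sel_plan z : exists2 pi, plans (sel_weight z) pi &
  (\int[pi]_xy (c xy)%:E = (dot z (sel_weight z) + Mmin z)%:E)%E.
Proof.
have [pi [piE piI]] := probability_pushforward Q (mselect z).
exists pi.
- split=> [A mA|B mB]; rewrite piE; last by congr (Q _); apply/seteqP; split => y //= [].
  rewrite (_ : _ @^-1` _ = [set y | A (x (sel z y))]); last first.
    by apply/seteqP; split => y //= [].
  have mS : measurable [set y : borel Y | A (x (sel z y))].
    have := measurableT_comp mfst (mselect z).
    by move=> /(_ measurableT A mA); rewrite setTI.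
  have := sel_expectation z (fun i => \1_A (x i : borel X)).
  rewrite (_ : (fun y => _) = (fun y => (\1_[set y | A (x (sel z y))] y)%:E)).
    rewrite integral_indic// setIT => ->.
    by apply: eq_bigr => i _; rewrite diracE sel_weightE muleC indicE.
  by apply/funext => y; rewrite !indicE; congr ((_ : bool)%:R%:E); apply/idP/idP; rewrite !inE.
- rewrite piI; last 2 first.
  + exact/measurable_EFinP.
  + by move=> y; rewrite lee_fin.
  rewrite (eq_integral (fun y => (cmin z y)%:E + (z 0 (sel z y))%:E)%E); last first.
    by move=> y _; rewrite -EFinD /cmin subrK.
  have mz : measurable_fun setT (fun y : borel Y => z 0 (sel z y)).
    apply: (measurable_fun_glue (g_ := fun i (y : borel Y) => z 0 i) (mcell z) (cell_cover z)) => //.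
    by move=> i y /selE ->.
  have zint : Q.-integrable setT (fun y : borel Y => (z 0 (sel z y))%:E).
    by apply: (bounded_integrable Q mz); exists (znorm z) => y; exact: znorm_ge.
  rewrite (integralD measurableT (cmin_int z) zint).
  rewrite MminE (sel_expectation z (z 0)) addeC EFinD; congr (_ + _)%E.
  by rewrite /dot -sumEFin; apply: eq_bigr => i _; rewrite sel_weightE EFinM.
Qed.

(** The independent coupling, written as a mixture of copies of [Q] placed on the slices over the
    atoms; it provides the finite upper bound on the cost. *)
Let point_plan q : simplex q -> exists2 pi, plans q pi &
  (\int[pi]_xy (c xy)%:E = \sum_i (q 0 i)%:E * \int[Q]_y (f i y)%:E)%E.
Proof.
move=> [q0 q1].
have [P HP] := choice (fun i => probability_pushforward Q (membed i)).
have [pi [piE piI]] := probability_mixture P q0 q1.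
exists pi.
- split=> [A mA|B mB]; rewrite piE.
    apply: eq_bigr => i _; congr (_ * _)%E; rewrite (HP i).1 diracE.
    have [Ai|Ai] := boolP ((x i : borel X) \in A).
      rewrite inE in Ai; rewrite (_ : _ @^-1` _ = setT) ?(@probability_setT _ _ _ Q)//.
      by apply/seteqP; split.
    rewrite notin_setE in Ai; rewrite (_ : _ @^-1` _ = set0) ?measure0//.
    by apply/seteqP; split => // y [].
  transitivity (\sum_i (q 0 i)%:E * Q B)%E.
    apply: eq_bigr => i _; rewrite (HP i).1; congr (_ * Q _)%E.
    by apply/seteqP; split => y //= [].
  rewrite -ge0_sume_distrl; last by move=> i _; rewrite lee_fin.
  by rewrite sumEFin q1 mul1e.
- rewrite piI; last 2 first.
  + exact/measurable_EFinP.
  + by move=> y; rewrite lee_fin.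
  apply: eq_bigr => i _; congr (_ * _)%E; rewrite (HP i).2//.
  exact/measurable_EFinP.
Qed.

(** The inequality [zeta + cmin <= c] holds on the slices over the atoms, which carry all the mass
    of [pi]; integrating it separates the two marginals. *)
Let weak_duality q z pi : simplex q -> plans q pi ->
  ((dot z q + Mmin z)%:E <= \int[pi]_xy (c xy)%:E)%E.
Proof.
move=> [q0 q1] [pi1 pi2].
have mfstI (A : set (borel X)) : measurable A ->
    measurable (A `*` setT : set (borel (X * Y)%type)).
  move=> mA; rewrite (_ : _ `*` _ = setT `&` fst @^-1` A); first exact: mfst.
  by apply/seteqP; split => -[u v] //= [].
have mx i : measurable ([set x i] : set (borel X)) by exact: (@polish_measurable1 R).
have mdiag i := mfstI _ (mx i).
pose zeta (w : borel (X * Y)%type) : R := \sum_i z 0 i * \1_([set x i] `*` setT) w.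
have zeta_norm w : `|zeta w| <= znorm z.
  rewrite (le_trans (ler_norm_sum _ _ _))// ler_sum// => i _.
  rewrite normrM ler_piMr// indicE.
  by case: (_ \in _); rewrite ?normr1 ?normr0.
have zeta_x i v : zeta (x i, v) = z 0 i.
  rewrite /zeta (bigD1 i)//= indicE mem_set// mulr1 big1 ?addr0// => j ji.
  rewrite indicE memNset ?mulr0// => -[/= /x_inj ij _].
  by rewrite ij eqxx in ji.
have zetaE : EFin \o zeta =
    fun w => (\sum_i (z 0 i)%:E * (\1_([set x i] `*` setT) w)%:E)%E.
  by apply/funext => w /=; rewrite -sumEFin.
have zint i : pi.-integrable setT (fun w : borel (X * Y)%type =>
    (z 0 i)%:E * (\1_([set x i] `*` setT) w)%:E)%E.
  by apply: integrableZl => //; exact: integrable_indic.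
have zeta_int : pi.-integrable setT (EFin \o zeta).
  by rewrite zetaE; apply: integrable_sum.
have int_zeta : (\int[pi]_w (zeta w)%:E = (dot z q)%:E)%E.
  rewrite -[LHS]/(\int[pi]_w (EFin \o zeta) w)%E zetaE integral_sum//.
  rewrite /dot -sumEFin; apply: eq_bigr => i _.
  rewrite integralZl//; last exact: integrable_indic.
  rewrite integral_indic// setIT EFinM; congr (_ * _)%E.
  apply: etrans (pi1 _ (mx i)) _.
  rewrite (bigD1 i)//= diracE mem_set// mule1.
  rewrite big1 ?adde0// => j ji.
  rewrite diracE memNset ?mule0// => /= /x_inj ij.
  by rewrite ij eqxx in ji.
have [cmin_int' int_cmin] : pi.-integrable setT (EFin \o (cmin z \o snd)) /\
    (\int[pi]_w (cmin z w.2)%:E = (Mmin z)%:E)%E.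
  rewrite -MminE; apply: (@integral_image _ _ _ _ _ pi Q snd) => //.
  move=> B mB; rewrite -pi2//; congr (pi _).
  by apply/seteqP; split => -[u v] //= [].
(* The cost may have infinite integral under [pi]. Adding [Z] makes both sides nonnegative, so they
   can be compared without integrability of [c]. *)
pose Z : R := znorm z + znorm z.
have Z_int : pi.-integrable setT (fun=> Z%:E).
  by apply: (bounded_integrable pi (f := fun=> Z)) => //; exists `|Z|.
have int_Z : (\int[pi]_w Z%:E = Z%:E)%E.
  rewrite integral_cst//.
  exact: etrans (congr1 (fun e => Z%:E * e)%E (@probability_setT _ _ _ pi)) (mule1 _).
have Z0 : 0 <= Z by rewrite addr_ge0 ?sumr_ge0.
have H : (\int[pi]_w ((zeta w)%:E + (cmin z w.2)%:E + Z%:E) <=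
          \int[pi]_w ((c w)%:E + Z%:E))%E.
  apply: ae_ge0_le_integral => //.
  - move=> w _; rewrite -!EFinD lee_fin /Z.
    have := zeta_norm w; rewrite ler_norml => /andP[H1 _].
    have := cmin_lb z w.2; lra.
  - apply/measurable_EFinP; apply: measurable_funD => //.
    have /integrableP[/measurable_EFinP mzeta _] := zeta_int.
    have /integrableP[/measurable_EFinP mcm _] := cmin_int'.
    exact: measurable_funD.
  - by move=> w _; rewrite -EFinD lee_fin addr_ge0.
  - by apply/measurable_EFinP; exact: measurable_funD.
  - pose B := \bigcup_(i in [set: 'I_m.+1]) [set x i].
    have mB : measurable (B : set (borel X)) by apply: fin_bigcup_measurable.
    exists (~` B `*` setT); split.
    + by apply: mfstI; exact: measurableC.
    + apply: etrans (pi1 _ (measurableC mB)) _.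
      rewrite big1// => i _; rewrite diracE memNset ?mule0// => /=.
      by apply; exists i.
    + move=> [u v] /= H; split => //; apply: contra_not H => -[i _ ->] _.
      rewrite zeta_x -!EFinD lee_fin lerD2r.
      by have := sel_min z v i; rewrite -/(cmin z v) lerBrDr addrC.
have int_cZ : (\int[pi]_w ((c w)%:E + Z%:E) = \int[pi]_w (c w)%:E + Z%:E)%E.
  rewrite ge0_integralD ?int_Z//.
  - by move=> w _; rewrite lee_fin.
  - exact/measurable_EFinP.
move: H; rewrite int_cZ.
rewrite (integralD measurableT (integrableD measurableT zeta_int cmin_int') Z_int).
rewrite (integralD measurableT zeta_int cmin_int') int_Z.
rewrite leeD2rE// int_zeta int_cmin.
by rewrite EFinD.
Qed.

Definition optimal_value q : R := fine (optimal_cost q).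

Let Cbound : R := \sum_i fine (\int[Q]_y (f i y)%:E)%E.

Let optimal_cost_bounds q : simplex q -> (0 <= optimal_cost q <= Cbound%:E)%E.
Proof.
move=> qs; apply/andP; split.
  apply: le_ereal_inf_tmp => _ [pi _ <-]; apply: integral_ge0 => w _.
  by rewrite lee_fin.
have [pi pis piE] := point_plan qs.
apply: (@le_trans _ _ (\int[pi]_xy (c xy)%:E)%E).
  by apply: ereal_inf_lbound; exists pi.
rewrite piE /Cbound -sumEFin lee_sum// => i _.
have fi0 : (0 <= \int[Q]_y (f i y)%:E)%E.
  by apply: integral_ge0 => y _; rewrite lee_fin c_ge0.
rewrite fineK; last exact: integrable_fin_num (f_int i).
rewrite -[leRHS]mul1e lee_wpmul2r// lee_fin -qs.2 (bigD1 i)//= lerDl.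
by apply: sumr_ge0 => j _; exact: qs.1.
Qed.

Lemma optimal_costE q : simplex q -> optimal_cost q = (optimal_value q)%:E.
Proof.
move=> /optimal_cost_bounds/andP[H1 H2]; rewrite /optimal_value fineK//.
by rewrite ge0_fin_numE// (le_lt_trans H2)// ltry.
Qed.

Lemma optimal_value_bound q : simplex q -> 0 <= optimal_value q <= Cbound.
Proof.
by move=> qs; rewrite -!lee_fin -(optimal_costE qs) optimal_cost_bounds.
Qed.

Let near_optimal q e : simplex q -> 0 < e -> exists2 pi, plans q pi &
  (\int[pi]_xy (c xy)%:E <= (optimal_value q + e)%:E)%E.
Proof.
move=> qs e0.
have [|_ [pi piq <-] H] := @lb_ereal_inf_adherent R
    [set \int[pi]_xy (c xy)%:E | pi in plans q]%E _ e0.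
  by rewrite -/(optimal_cost q) optimal_costE.
by exists pi => //; rewrite EFinD -optimal_costE// ltW.
Qed.

Let simplex_convex q q' t : simplex q -> simplex q' -> 0 <= t <= 1 ->
  simplex (t *: q + (1 - t) *: q').
Proof.
move=> [q0 q1] [q'0 q'1] /andP[t0 t1]; split=> [i|].
  by rewrite !mxE addr_ge0// mulr_ge0// subr_ge0.
under eq_bigr do rewrite !mxE.
by rewrite big_split/= -!mulr_sumr q1 q'1 !mulr1 subrKC.
Qed.

(** A mixture of plans is a plan for the mixed weights and its cost is affine in the mixture; plans
    optimal up to [e] are mixed and [e] tends to 0. *)
Lemma optimal_value_convex q q' t : simplex q -> simplex q' -> 0 <= t <= 1 ->
  optimal_value (t *: q + (1 - t) *: q') <=
  t * optimal_value q + (1 - t) * optimal_value q'.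
Proof.
move=> qs q's t01; apply/ler_addgt0Pr => e e0.
have [pi piq piE] := near_optimal qs e0.
have [pi' piq' piE'] := near_optimal q's e0.
have [t0 t1] := andP t01.
pose w (i : 'I_2) := if i == ord0 then t else 1 - t.
pose P (i : 'I_2) := if i == ord0 then pi else pi'.
have w0 i : 0 <= w i by rewrite /w; case: ifP => //; rewrite subr_ge0.
have w1 : \sum_i w i = 1.
  by rewrite !big_ord_recl big_ord0 /w/= addr0 subrKC.
have [mix [mixE mixI]] := probability_mixture P w0 w1.
have mixq : plans (t *: q + (1 - t) *: q') mix.
  have mixE2 A : mix A = (t%:E * pi A + (1 - t)%:E * pi' A)%E.
    by rewrite mixE !big_ord_recl big_ord0 /w /P/= adde0.
  split=> [A mA|B mB]; rewrite mixE2.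
    rewrite piq.1// piq'.1// !ge0_sume_distrr; last 2 first.
    - by move=> i _; rewrite mule_ge0// lee_fin (qs.1, q's.1).
    - by move=> i _; rewrite mule_ge0// lee_fin (qs.1, q's.1).
    rewrite -big_split/=; apply: eq_bigr => i _.
    by rewrite !muleA -ge0_muleDl ?lee_fin ?mulr_ge0 ?qs.1 ?q's.1 ?subr_ge0// !mxE.
  by rewrite piq.2// piq'.2// -ge0_muleDl ?lee_fin ?subr_ge0// -EFinD subrKC mul1e.
rewrite -lee_fin -optimal_costE; last exact: simplex_convex.
apply: (@le_trans _ _ (\int[mix]_xy (c xy)%:E)%E).
  by apply: ereal_inf_lbound; exists mix.
rewrite mixI; last 2 first.
- exact/measurable_EFinP.
- by move=> y; rewrite lee_fin.
rewrite !big_ord_recl big_ord0 /w /P/= adde0.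
have -> : t * optimal_value q + (1 - t) * optimal_value q' + e =
    t * (optimal_value q + e) + (1 - t) * (optimal_value q' + e) by ring.
rewrite [leRHS]EFinD [X in (_ <= X + _)%E]EFinM [X in (_ <= _ + X)%E]EFinM.
by rewrite leeD// lee_wpmul2l// lee_fin subr_ge0.
Qed.

(** Equality in the Fenchel inequality. From [Opt], weak duality at every [q] yields the subgradient
    inequality; conversely that inequality is tested at [sel_weight z], where duality is exact. *)
Lemma Opt_subgradient (P : {measure set (borel X) -> \bar R}) p z : simplex p ->
  (forall A : set (borel X), measurable A ->
     P A = \sum_k (p 0 k)%:E * \d_(x k : borel X) A)%E ->
  Opt c x p P Q z <-> subgradient optimal_value p z.
Proof.
move=> ps PE; rewrite /Opt/= (transport_costE PE) optimal_costE// dual_objE//.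
have weak q : simplex q -> dot z q + Mmin z <= optimal_value q.
  move=> qs; rewrite -lee_fin -optimal_costE//.
  by apply: le_ereal_inf_tmp => _ [pi piq <-]; exact: weak_duality.
have dotB q : dot z (q - p) = dot z q - dot z p.
  by rewrite !(dotC z) dotDl dotNl.
split=> [[pE] q qs|zs].
  by rewrite pE dotB; have := weak q qs; lra.
congr (_%:E); apply/eqP; rewrite eq_le weak// andbT.
have [pi piq piE] := sel_plan z.
have := zs _ (simplex_sel_weight z); rewrite dotB.
have : optimal_value (sel_weight z) <= dot z (sel_weight z) + Mmin z.
  rewrite -lee_fin -optimal_costE// -piE.
  by apply: ereal_inf_lbound; exists pi.
lra.
Qed.

End semidiscrete.

(** * Empirical weights and their central limit theorem *)

Section iid_expectation_tuples.
Context {R : realType} {A : finType}.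
Variables (q : A -> R).

Lemma iidE_eq_op (t : seq A) :
  iidE q (size t) (fun s => (s == t)%:R) = \prod_(a <- t) q a.
Proof.
elim: t => [|a t IH] /=; first by rewrite big_nil.
rewrite big_cons (bigD1 a)//= big1 ?addr0 => [|b ba].
  rewrite -IH; congr (_ * _); apply: eq_iidE => s _.
  by rewrite eqseq_cons eqxx.
rewrite (_ : iidE _ _ _ = 0) ?mulr0//.
rewrite -[RHS](mul0r (iidE q (size t) (fun=> 0))) -iidEZ.
by apply: eq_iidE => s _; rewrite eqseq_cons (negbTE ba) mul0r.
Qed.

Lemma sum_tuple_eq n (F : seq A -> R) (s : seq A) : size s = n ->
  F s = \sum_(t : n.-tuple A) F t * (s == t)%:R.
Proof.
move=> sn; have sn' : size s == n by apply/eqP.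
rewrite (bigD1 (Tuple sn'))//= eqxx mulr1 big1 ?addr0// => t ts.
rewrite (_ : s == t = false) ?mulr0//; apply: contraNF ts => /eqP st.
by apply/eqP/val_inj.
Qed.

(** The sum over all words of length [n], the form that can be matched with the probabilities of the
    sample events. *)
Lemma iidE_tuple n F :
  iidE q n F = \sum_(t : n.-tuple A) F t * \prod_(a <- t) q a.
Proof.
rewrite (@eq_iidE _ _ _ _ _ (fun s => \sum_(t : n.-tuple A) F t * (s == t)%:R)).
  rewrite iidE_sum; apply: eq_bigr => t _.
  by rewrite iidEZ -iidE_eq_op size_tuple.
by move=> s; exact: sum_tuple_eq.
Qed.

End iid_expectation_tuples.

Section count_weights.
Context {R : realType} {m : nat}.

Definition count_weights n (s : seq 'I_m.+1) : 'rV[R]_m.+1 :=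
  \row_i ((\sum_(a <- s) (a == i)%:R) / n%:R).

Lemma simplex_count_weights n s : (0 < n)%N -> size s = n ->
  simplex (count_weights n s).
Proof.
move=> n0 sn; split=> [i|]; first by rewrite mxE divr_ge0// sumr_ge0.
under eq_bigr do rewrite mxE.
rewrite -mulr_suml exchange_big/= (eq_bigr (fun=> 1)) => [|a _]; last first.
  by rewrite (bigD1 a)//= eqxx big1 ?addr0// => i /negbTE ia; rewrite eq_sym ia.
by rewrite big_const_seq count_predT sn iter_addr_0 divff// pnatr_eq0 -lt0n.
Qed.

End count_weights.

(** * From the random sample to finite words of atoms *)

Section sampling.
Context {R : realType} {X : ptopologicalType} {m : nat}.
Variables (polX : polish R X) (x : 'I_m.+1 -> X) (x_inj : injective x).
Variables (p : 'rV[R]_m.+1) (P : probability (borel X) R).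
Hypothesis P_def : forall A : set (borel X), measurable A ->
    P A = (\sum_k (p 0 k)%:E * \d_(x k : borel X) A)%E.
Context (d : measure_display) (W : measurableType d).
Variables (Pr : probability W R) (xi : nat -> {RV Pr >-> borel X}).
Hypothesis xi_iid : iid_sample P xi.

(** Points off the atoms receive the default [ord0]. Its fibre is therefore the complement of the
    other atoms, still measurable and of the same [P]-mass as the atom itself. *)
Let atom (u : X) : 'I_m.+1 := xget ord0 [set i | u = x i].

Let atomK i : atom (x i) = i.
Proof.
by rewrite /atom; case: xgetP => [j _ /x_inj//|/(_ i) /(_ erefl)].
Qed.

Let matom i : measurable (atom @^-1` [set i] : set (borel X)).
Proof.
have mx j : measurable ([set x j] : set (borel X)) by exact: (@polish_measurable1 R).
have H (i' : 'I_m.+1) : i' != ord0 -> atom @^-1` [set i'] = [set x i'].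
  move=> i0; apply/seteqP; split => u /=; last by move=> ->; exact: atomK.
  rewrite /atom; case: xgetP => [j _ -> <-//|_ E].
  by rewrite E eqxx in i0.
have [->|/H -> //] := eqVneq i ord0.
rewrite (_ : _ @^-1` _ = ~` \bigcup_(j in [set j | j != ord0]) [set x j]).
  apply: measurableC; apply: fin_bigcup_measurable => [|j _]; last exact: mx.
  exact: finite_finset.
apply/seteqP; split => u /=.
  by move=> u0 [j /= j0] uj; move: j0; rewrite -u0 uj atomK eqxx.
move=> H'; apply: contrapT => u0; apply: H'.
exists (atom u); first by apply/eqP.
by move: u0; rewrite /atom; case: xgetP.
Qed.

Let P_atom i : P (atom @^-1` [set i]) = (p 0 i)%:E.
Proof.
rewrite (P_def (matom i)) (bigD1 i)//= diracE mem_set ?mule1; last exact: atomK.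
rewrite big1 ?adde0// => j ji; rewrite diracE memNset ?mule0// => /=.
by rewrite atomK => E; rewrite E eqxx in ji.
Qed.

Definition sample n (w : W) : seq 'I_m.+1 := mkseq (fun k => atom (xi k w)) n.

Lemma size_sample n w : size (sample n w) = n.
Proof. exact: size_mkseq. Qed.

Let sample_eq n (t : n.-tuple 'I_m.+1) : [set w | sample n w = t] =
  \bigcap_(k in [set` [fset k in iota 0 n]%fset])
     (xi k @^-1` (atom @^-1` [set nth ord0 t k])).
Proof.
apply/seteqP; split => w /=.
  by move=> <- k /=; rewrite in_fset mem_iota /= => kn; rewrite nth_mkseq.
move=> H; apply: (@eq_from_nth _ ord0); first by rewrite size_sample size_tuple.
move=> k; rewrite size_sample => kn; rewrite nth_mkseq//.
by apply: H; rewrite /= in_fset mem_iota.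
Qed.

Let msample_eq n (t : n.-tuple 'I_m.+1) : measurable [set w | sample n w = t].
Proof.
rewrite sample_eq; apply: fin_bigcap_measurable; first exact: finite_fset.
by move=> k _; apply: measurable_funPTI; exact: matom.
Qed.

Let P_sample_eq n (t : n.-tuple 'I_m.+1) :
  Pr [set w | sample n w = t] = (\prod_(i <- t) p 0 i)%:E.
Proof.
rewrite sample_eq (xi_iid.1 _ (fun k => atom @^-1` [set nth ord0 t k])); last by move=> k.
transitivity (\prod_(k <- iota 0 n) (p 0 (nth ord0 t k))%:E)%E.
  have perm : perm_eq (enum_fset [fset k in iota 0 n]%fset) (iota 0 n).
    apply: uniq_perm; [exact: fset_uniq|exact: iota_uniq|].
    by move=> k; rewrite in_fset.
  rewrite (perm_big _ perm)/=; apply: eq_bigr => k _.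
  by rewrite -P_atom -(xi_iid.2 k)//; exact: matom.
rewrite prodEFin; congr (_%:E).
rewrite -{2}[tval t](mkseq_nth ord0) size_tuple /mkseq big_map.
by [].
Qed.

Lemma measurable_sample d' (T : measurableType d') n (F : seq 'I_m.+1 -> T) :
  measurable_fun setT (fun w => F (sample n w)).
Proof.
apply: (measurable_fun_glue (A := fun t : n.-tuple 'I_m.+1 => [set w | sample n w = t])
  (g_ := fun t _ => F t)) => //.
- move=> w; have sn : size (sample n w) == n by rewrite size_sample.
  by exists (Tuple sn).
- by move=> t w /= ->.
Qed.

(** The only place where the joint law of the draws is used: afterwards expectations are finite
    sums. *)
Lemma expectation_sample n (F : seq 'I_m.+1 -> R) :
  (\int[Pr]_w (F (sample n w))%:E = (iidE (p 0) n F)%:E)%E.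
Proof.
rewrite (eq_integral (fun w => \sum_(t : n.-tuple 'I_m.+1)
    (F t)%:E * (\1_[set w | sample n w = t] w)%:E)%E); last first.
  move=> w _; rewrite (sum_tuple_eq F (size_sample n w)) -sumEFin.
  apply: eq_bigr => t _; rewrite EFinM; congr (_ * _%:E)%E.
  by rewrite indicE; congr ((_ : bool)%:R); apply/eqP/idP; rewrite inE.
have ind_int (t : n.-tuple 'I_m.+1) :
    Pr.-integrable setT (fun w => (\1_[set w | sample n w = t] w)%:E).
  by apply: integrable_indic; exact: msample_eq.
rewrite integral_sum//; last by move=> t; exact: integrableZl.
rewrite iidE_tuple -sumEFin; apply: eq_bigr => t _.
rewrite (integralZl measurableT (ind_int t)) integral_indic//.
rewrite setIT EFinM; congr (_ * _)%E; exact: P_sample_eq.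
Qed.

(** A draw may miss the atoms on a null event. Countably many such events are discarded at once, so
    the identity holds for all [n] and [A] simultaneously. *)
Lemma empirical_sample : {ae Pr, forall w, forall n, (0 < n)%N ->
  forall A : set (borel X), measurable A ->
  (empirical (fun k w => xi k w) n w : {measure set (borel X) -> \bar R}) A =
  (\sum_k (count_weights n (sample n w) 0 k)%:E * \d_(x k : borel X) A)%E}.
Proof.
have : {ae Pr, forall w, forall k, xi k w = x (atom (xi k w))}.
  apply: ae_foralln => k.
  pose B : set (borel X) := \bigcup_(i in [set: 'I_m.+1]) [set x i].
  have mB : measurable B.
    by apply: fin_bigcup_measurable => // i _; exact: (@polish_measurable1 R).
  exists (xi k @^-1` ~` B); split.
  - by apply: measurable_funPTI; exact: measurableC.
  - apply: etrans (xi_iid.2 k _ (measurableC mB)) _.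
    rewrite (P_def (measurableC mB)) big1// => i _.
    by rewrite diracE memNset ?mule0//= => /(_ (ex_intro2 _ _ i Logic.I erefl)).
  - move=> w /= H [i _ xiE]; apply: H.
    by rewrite xiE atomK.
apply: filterS => w wE n n0 A mA.
pose g i : R := ((x i : borel X) \in A)%:R.
transitivity (n%:R^-1 * \sum_(a <- sample n w) g a)%:E.
  rewrite /empirical /mscale/= /msum EFinM; congr (_ * _)%E.
  rewrite /sample /mkseq big_map -sumEFin.
  rewrite (_ : iota 0 n = index_iota 0 n) ?big_mkord; last by rewrite /index_iota subn0.
  apply: eq_bigr => k _; rewrite /dirac/=.
  by rewrite /g -wE.
under [RHS]eq_bigr do rewrite diracE -EFinM mxE.
rewrite sumEFin; congr (_%:E).
transitivity (n%:R^-1 * \sum_i (\sum_(a <- sample n w) (a == i)%:R) * g i).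
  congr (_ * _); under [RHS]eq_bigr do rewrite mulr_suml.
  rewrite exchange_big/=; apply: eq_bigr => a _.
  by rewrite (bigD1 a)//= eqxx mul1r big1 ?addr0// => i /negbTE ia; rewrite eq_sym ia mul0r.
by rewrite mulr_sumr; apply: eq_bigr => i _; rewrite mulrA (mulrC _^-1).
Qed.

End sampling.

(** * Central limit theorem and delta method for counts *)

Section multinomial_clt.
Context {R : realType} {m : nat}.
Variable p : 'rV[R]_m.+1.
Hypotheses (p_ge0 : forall i, 0 <= p 0 i) (p1 : \sum_i p 0 i = 1).
Implicit Types t : 'rV[R]_m.+1.

Definition deviation n (s : seq 'I_m.+1) : 'rV[R]_m.+1 :=
  \row_i ((\sum_(a <- s) ((a == i)%:R - p 0 i)) / Num.sqrt n%:R).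

Let indic_sum (a : 'I_m.+1) (g : 'I_m.+1 -> R) : \sum_i g i * (a == i)%:R = g a.
Proof.
rewrite (bigD1 a)//= eqxx mulr1 big1 ?addr0// => i /negbTE ia.
by rewrite eq_sym ia mulr0.
Qed.

Lemma deviation_total n s : \sum_i deviation n s 0 i = 0.
Proof.
under eq_bigr do rewrite mxE.
rewrite -mulr_suml exchange_big/= big1 ?mul0r// => a _.
rewrite sumrB p1; have := indic_sum a (fun=> 1).
by under eq_bigr do rewrite mul1r; move=> ->; rewrite subrr.
Qed.

Lemma count_weightsE n s : (0 < n)%N -> size s = n ->
  count_weights n s = p + (Num.sqrt n%:R)^-1 *: deviation n s.
Proof.
move=> n0 sn; apply/rowP => i; rewrite !mxE.
have nR : n%:R = Num.sqrt n%:R ^+ 2 :> R by rewrite sqr_sqrtr ?ler0n.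
have sq0 : Num.sqrt n%:R != 0 :> R by rewrite gt_eqF// sqrtr_gt0 ltr0n.
rewrite sumrB big_const_seq count_predT sn iter_addr_0 -[p 0 i *+ n]mulr_natr.
have H (S q : R) : q != 0 ->
    S / q ^+ 2 = p 0 i + q^-1 * ((S - p 0 i * q ^+ 2) / q) by move=> q0; field.
by have := H (\sum_(a <- s) (a == i)%:R) _ sq0; rewrite -nR.
Qed.

(** The linear form [t] on one draw, centred; [t . deviation] is then a normalised sum of such
    terms. *)
Let z t (a : 'I_m.+1) : R := t 0 a - dot t p.

Lemma dot_deviation t n s :
  dot t (deviation n s) = (\sum_(a <- s) z t a) / Num.sqrt n%:R.
Proof.
rewrite /dot; under eq_bigr do rewrite mxE mulrA mulr_sumr.
rewrite -mulr_suml exchange_big/=; congr (_ / _); apply: eq_bigr => a _.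
by under eq_bigr do rewrite mulrBr; rewrite sumrB indic_sum.
Qed.

Let z_mean t : \sum_a p 0 a * z t a = 0.
Proof.
under eq_bigr do rewrite mulrBr.
by rewrite sumrB -mulr_suml p1 mul1r [X in _ - X]dotC subrr.
Qed.

Let z_var t : \sum_a p 0 a * z t a ^+ 2 = (t *m Sigma p *m t^T) 0 0.
Proof.
have -> : \sum_a p 0 a * z t a ^+ 2 = \sum_a p 0 a * t 0 a ^+ 2 - dot t p ^+ 2.
  transitivity (\sum_a (p 0 a * t 0 a ^+ 2 - (t 0 a * p 0 a) * (2 * dot t p) +
      p 0 a * dot t p ^+ 2)).
    by apply: eq_bigr => a _; rewrite /z; ring.
  by rewrite big_split/= sumrB -!mulr_suml p1 -/(dot t p); ring.
rewrite mxE; under [RHS]eq_bigr do rewrite mxE [t^T _ _]mxE.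
transitivity (\sum_j (p 0 j * t 0 j ^+ 2 - dot t p * (t 0 j * p 0 j))).
  by rewrite sumrB -mulr_sumr expr2.
apply: eq_bigr => j _.
have -> : \sum_i t 0 i * Sigma p i j = \sum_i (t 0 i * p 0 i) * (j == i)%:R -
   (\sum_i t 0 i * p 0 i) * p 0 j.
  rewrite mulr_suml -sumrB; apply: eq_bigr => i _; rewrite mxE eq_sym.
  by have [->|ij] := eqVneq j i; rewrite ?mulr1 ?mulr0; ring.
by rewrite indic_sum -/(dot t p); ring.
Qed.

Lemma covariance_ge0 t : 0 <= (t *m Sigma p *m t^T) 0 0.
Proof. by rewrite -z_var sumr_ge0// => a _; rewrite mulr_ge0// sqr_ge0. Qed.

(** Centred indicators are bounded by 1 in absolute value. The bound is uniform in [n] and supplies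
    the tightness behind [tail_bound]. *)
Lemma iidE_deviation_sqr n i : (0 < n)%N ->
  iidE (p 0) n (fun s => deviation n s 0 i ^+ 2) <= 1.
Proof.
move=> n0; have nR0 : n%:R != 0 :> R by rewrite pnatr_eq0 -lt0n.
have -> : iidE (p 0) n (fun s => deviation n s 0 i ^+ 2) =
  n%:R^-1 * iidE (p 0) n (fun s => (\sum_(a <- s) z (delta_mx 0 i) a) ^+ 2).
  rewrite -iidEZ; apply: eq_iidE => s _.
  by rewrite -[deviation n s 0 i]dot_delta dot_deviation expr_div_n sqr_sqrtr ?ler0n// mulrC.
rewrite (iidE_sqr_sum p1 n (z_mean _)) mulKf//.
rewrite -[leRHS]p1; apply: ler_sum => a _; rewrite ler_piMr//.
rewrite -real_normK ?num_real// expr_le1// /z dotC dotC dot_delta mxE eqxx/=.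
have pi1 : p 0 i <= 1.
  by rewrite -p1 (bigD1 i)//= lerDl sumr_ge0.
have := p_ge0 i; case: (a == i); rewrite ler_norml /= => pi0; apply/andP; split; lra.
Qed.

Section limit.
Context (d : measure_display) (W : measurableType d) (P : probability W R).
Variable G : 'I_m.+1 -> {RV P >-> R}.
Hypothesis G_law : gaussian_vector 0 (Sigma p) G.

Definition vec w : 'rV[R]_m.+1 := \row_i G i w.

Lemma dot_vec t w : dot t (vec w) = \sum_i t 0 i * G i w.
Proof. by apply: eq_bigr => i _; rewrite mxE. Qed.

Let measurable_dot t : measurable_fun setT (fun w => dot t (vec w)).
Proof.
rewrite /dot; apply: measurable_sum => i; apply: measurable_funM => //.
by under eq_fun do rewrite mxE; exact: measurable_funPT.
Qed.

Lemma measurable_trig T : trig T -> measurable_fun setT (fun w => T (vec w)).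
Proof.
elim=> [th t|f g _ mf _ mg|k f _ mf].
- exact: (measurableT_comp (measurable_cosD th) (measurable_dot t)).
- exact: measurable_funD.
- exact: measurable_funM.
Qed.

Let trig_bounded T : trig T -> exists M, forall x : 'rV[R]_m.+1, `|T x| <= M.
Proof.
elim=> [th t|f g _ [M fM] _ [N gN]|k f _ [M fM]].
- by exists 1 => x; exact: cos_max.
- by exists (M + N) => x; rewrite (le_trans (ler_normD _ _))// lerD.
- by exists (`|k| * M) => x; rewrite normrM ler_wpM2l.
Qed.

Lemma integrable_trig T : trig T -> P.-integrable setT (fun w => (T (vec w))%:E).
Proof.
move=> tT; apply: (bounded_integrable P (measurable_trig tT)).
by have [M TM] := trig_bounded tT; exists M.
Qed.

(** A Cramer-Wold argument: a single cosine sees only one linear form, whose Gaussian law is known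
    by hypothesis; linearity does the rest. *)
Lemma trig_clt T : trig T ->
  iidE (p 0) n (fun s => T (deviation n s)) @[n --> \oo] -->
  fine (\int[P]_w (T (vec w))%:E)%E.
Proof.
elim=> [th t|f g tf cf tg cg|k f tf cf].
- rewrite (@expectation_cos_normal_law R d W P _ ((t *m Sigma p *m t^T) 0 0) th); first last.
  + move=> A mA; have := G_law t mA; rewrite trmx0 mulmx0 mxE => <-.
    congr (P _); apply/seteqP.
    by split => w /=; rewrite dot_vec.
  + exact: measurable_dot.
  + exact: covariance_ge0.
  rewrite /= -z_var.
  under eq_fun do under eq_iidE do rewrite dot_deviation.
  exact: iidE_cos_cvg.
- rewrite (_ : fine _ = fine (\int[P]_w (f (vec w))%:E)%E + fine (\int[P]_w (g (vec w))%:E)%E).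
    under eq_fun do rewrite iidED.
    exact: cvgD.
  under eq_integral do rewrite EFinD.
  rewrite integralD//; [|exact: integrable_trig..].
  by rewrite fineD//; exact: integrable_fin_num (integrable_trig _).
- rewrite (_ : fine _ = k * fine (\int[P]_w (f (vec w))%:E)%E).
    under eq_fun do rewrite iidEZ.
    exact: cvgMl_tmp.
  under eq_integral do rewrite EFinM.
  rewrite integralZl//; last exact: integrable_trig.
  by rewrite fineM//; exact: integrable_fin_num (integrable_trig _).
Qed.

Lemma vec_total_eq0 : {ae P, forall w, \sum_i vec w 0 i = 0}.
Proof.
(* The all-ones form is constant after centring, so its variance is 0 and its law is the Dirac mass
   at 0. *)
pose t : 'rV[R]_m.+1 := const_mx 1.
have tE w : dot t (vec w) = \sum_i vec w 0 i.
  by apply: eq_bigr => i _; rewrite mxE mul1r.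
have m0 : measurable ([set~ 0] : set R) by exact: measurableC.
exists [set w | dot t (vec w) != 0]; split.
- rewrite (_ : [set w | _] = (fun w => dot t (vec w)) @^-1` [set~ 0]).
    by rewrite -[X in measurable X]setTI; exact: measurable_dot.
  by apply/seteqP; split => w /= /eqP.
- have := G_law t m0; rewrite trmx0 mulmx0 mxE -z_var big1; last first.
    move=> a _; rewrite /z (_ : dot t p = 1) ?mxE ?subrr ?expr0n ?mulr0//.
    by rewrite -[RHS]p1; apply: eq_bigr => i _; rewrite mxE mul1r.
  rewrite /normal_law eqxx diracE memNset; last by move=> /(_ erefl).
  move=> H; apply: etrans H; congr (P _).
  by apply/seteqP; split => w /=; rewrite dot_vec => /eqP.
- by move=> w /= H; apply/eqP => E; apply: H; rewrite -tE.
Qed.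

(** The boxes grow while the errors shrink. A bound [M j] for each box, rather than one constant,
    also admits unbounded [g], as [measurable_vec] requires. *)
Let approximants (g : 'rV[R]_m.+1 -> R) (M : nat -> R) : continuous g ->
  (forall j y, `|y| <= 2 * j.+1%:R -> `|g y| <= M j) ->
  exists T : nat -> 'rV[R]_m.+1 -> R, [/\ forall j, trig (T j),
    forall j x, `|T j x| <= M j &
    forall j x, `|x| <= j.+1%:R -> `|T j x - g x| <= j.+1%:R^-1].
Proof.
move=> gc gM.
have H j : exists T : 'rV[R]_m.+1 -> R, [/\ trig T, forall x, `|T x| <= M j &
    forall x, `|x| <= j.+1%:R -> `|T x - g x| <= j.+1%:R^-1].
  by apply: trig_approx => //; exact: gM.
have [T TP] := choice H.
by exists T; split => j; have [] := TP j.
Qed.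

Let approximants_cvg (g : 'rV[R]_m.+1 -> R) (T : nat -> 'rV[R]_m.+1 -> R) y :
  (forall j x, `|x| <= j.+1%:R -> `|T j x - g x| <= j.+1%:R^-1) ->
  T j y @[j --> \oo] --> g y.
Proof.
move=> Tg; apply/cvgrPdist_le => e e0.
have /cvgrPdist_le/(_ _ e0) := @cvg_harmonic R.
apply: filter_app; near=> j => Hj.
rewrite distrC (le_trans (Tg _ _ _))//.
  rewrite ltW// (lt_trans (truncnS_gt _))// ltr_nat ltnS.
  by near: j; exact: nbhs_infty_gt.
by move: Hj; rewrite sub0r normrN; apply: le_trans; exact: ler_norm.
Unshelve. all: by end_near. Qed.

(** A pointwise limit of measurable trigonometric sums; no sigma-algebra on row vectors enters. *)
Lemma measurable_vec (g : 'rV[R]_m.+1 -> R) : continuous g ->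
  measurable_fun setT (fun w => g (vec w)).
Proof.
move=> gc.
have [M gM] := choice (fun j : nat => continuous_bounded_ball (2 * j.+1%:R) gc).
have [T [Ttrig _ Tg]] := approximants gc gM.
apply: (measurable_fun_cvg (h := fun j w => T j (vec w))).
  by move=> j; exact: measurable_trig.
by move=> w _; exact: approximants_cvg.
Qed.

Let tail_bound n (F : seq 'I_m.+1 -> R) e B : (0 < n)%N -> 0 <= B ->
  (forall s, size s = n -> `|F s| <= e + B * \sum_i deviation n s 0 i ^+ 2) ->
  `|iidE (p 0) n F| <= e + B * m.+1%:R.
Proof.
move=> n0 B0 H; rewrite (le_trans (iidE_norm p_ge0 _ _))//.
rewrite (le_trans (iidE_le p_ge0 H))// iidED (iidE_cst p1) lerD2l iidEZ.
rewrite ler_wpM2l// iidE_sum -[in leRHS](card_ord m.+1) -sumr_const ler_sum// => i _.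
exact: iidE_deviation_sqr.
Qed.

(** [F n] is close to [g] of the deviation only on bounded sets. Beyond them the common bound [M] is
    combined with the uniform second moments. *)
Lemma multinomial_delta (g : 'rV[R]_m.+1 -> R) (F : nat -> seq 'I_m.+1 -> R) M :
  continuous g -> (forall y, `|g y| <= M) -> (forall n s, `|F n s| <= M) ->
  (forall K e, 0 < e -> \forall n \near \oo, forall s, size s = n ->
     `|deviation n s| <= K -> `|F n s - g (deviation n s)| <= e) ->
  iidE (p 0) n (F n) @[n --> \oo] --> fine (\int[P]_w (g (vec w))%:E)%E.
Proof.
move=> gc gM FM FG.
have M0 : 0 <= M := le_trans (normr_ge0 _) (gM 0).
have [T [Ttrig TM Tg]] := approximants gc (fun j y _ => gM y).
have mg := measurable_vec gc.
have g_int := bounded_integrable P mg (ex_intro _ M (fun w => gM (vec w))).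
have cvgT : fine (\int[P]_w (T j (vec w))%:E)%E @[j --> \oo] -->
    fine (\int[P]_w (g (vec w))%:E)%E.
  apply: fine_cvg; rewrite fineK; last exact: integrable_fin_num g_int.
  have [] := @dominated_convergence _ _ _ P setT measurableT
    (fun j w => (T j (vec w))%:E) (fun w => (g (vec w))%:E) (cst M%:E) => //.
  - by move=> j; apply/measurable_EFinP; exact: measurable_trig.
  - exact/measurable_EFinP.
  - apply: aeW => w _; apply: cvg_EFin; first exact: nearW.
    exact: approximants_cvg.
  - by apply: (bounded_integrable P (f := cst M)) => //; exists `|M|.
  - by apply: aeW => w j _; rewrite /= lee_fin.
apply/cvgrPdist_le => e e0.
have e40 : 0 < e / 4 by rewrite divr_gt0.
move/cvgrPdist_le : cvgT => /(_ _ e40) cvgT.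
have d0 : 0 < (1 + 2 * M * m.+1%:R)^-1 * (e / 4).
  by rewrite mulr_gt0// invr_gt0 ltr_pwDl// !mulr_ge0.
have /cvgrPdist_le/(_ _ d0) cvgh := @cvg_harmonic R.
(* The box and its approximant are fixed before [n], because the central limit theorem is applied to
   one trigonometric sum at a time. *)
near \oo => j.
have K0 : 0 < j.+1%:R :> R by [].
have Tj : `|fine (\int[P]_w (g (vec w))%:E)%E - fine (\int[P]_w (T j (vec w))%:E)%E| <= e / 4.
  by near: j.
have tail : j.+1%:R^-1 + 2 * M * m.+1%:R * j.+1%:R^-1 <= e / 4.
  rewrite -[X in X + _]mul1r -mulrDl -ler_pdivlMl; last first.
    by rewrite ltr_pwDl// !mulr_ge0.
  rewrite -[leLHS]ger0_norm// -[leLHS]normrN -[- _]add0r; near: j.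
  exact: cvgh.
have /cvgrPdist_le/(_ _ e40) cT := trig_clt (Ttrig j).
near=> n.
have n0 : (0 < n)%N by near: n; exact: nbhs_infty_gt.
have cTn : `|fine (\int[P]_w (T j (vec w))%:E)%E -
    iidE (p 0) n (fun s => T j (deviation n s))| <= e / 4.
  by near: n.
have FGn : forall s, size s = n -> `|deviation n s| <= j.+1%:R ->
    `|F n s - g (deviation n s)| <= e / 4.
  by near: n; exact: FG.
have H : `|iidE (p 0) n (fun s => T j (deviation n s)) - iidE (p 0) n (F n)| <= e / 4 + e / 4.
  rewrite -iidEB.
  have B0 : 0 <= 2 * M * j.+1%:R^-1 by rewrite !mulr_ge0 ?invr_ge0.
  apply: (@le_trans _ _ ((e / 4 + j.+1%:R^-1) + 2 * M * j.+1%:R^-1 * m.+1%:R)); last first.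
    by rewrite -addrA lerD2l mulrAC.
  apply: tail_bound => // s sn.
  have sq0 : 0 <= \sum_i deviation n s 0 i ^+ 2.
    by apply: sumr_ge0 => i _; exact: sqr_ge0.
  have [sK|sK] := leP `|deviation n s| j.+1%:R.
    apply: (@le_trans _ _ (e / 4 + j.+1%:R^-1)); last by rewrite lerDl mulr_ge0.
    rewrite distrC -(subrKA (g (deviation n s))) (le_trans (ler_normD _ _))//.
    rewrite lerD ?FGn// distrC; exact: Tg.
  apply: (@le_trans _ _ (2 * M)).
    rewrite (le_trans (ler_normB _ _))// (_ : 2 * M = M + M); last by ring.
    by rewrite lerD.
  have [i Ki] : exists i, j.+1%:R <= `|deviation n s 0 i|.
    apply: contrapT => /forallNP nd; move: sK; apply/negP; rewrite -leNgt.
    apply: norm_le_coord => // i; rewrite leNgt.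
    by apply/negP => /ltW; exact: nd.
  (* Outside the box some coordinate is at least [j.+1] in absolute value, and its square is at
     least [j.+1] since [j.+1 >= 1]. Hence [2 * M] is at most [2 * M / j.+1] times the sum of
     squares. *)
  have Ki2 : j.+1%:R <= \sum_i deviation n s 0 i ^+ 2.
    rewrite (bigD1 i)//= -[leLHS]addr0 lerD//; last first.
      by apply: sumr_ge0 => k _; exact: sqr_ge0.
    rewrite -real_normK ?num_real// (le_trans Ki)// expr2 ler_peMl//.
    by rewrite (le_trans _ Ki)// ler1n.
  rewrite -[leLHS]add0r lerD//.
    by rewrite addr_ge0// ltW.
  rewrite -mulrA ler_peMr ?mulr_ge0//.
  by rewrite ler_pdivlMl// mulr1.
rewrite -(subrKA (fine (\int[P]_w (T j (vec w))%:E)%E)) (le_trans (ler_normD _ _))//.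
(* The four quarters: replacing [g] by [T j] in the limit, the central limit theorem for [T j], the
   gap between [F n] and [g] on the box, and the approximation error there plus the tail. *)
rewrite (_ : e = e / 4 + (e / 4 + (e / 4 + e / 4))); last by field.
rewrite lerD// -(subrKA (iidE (p 0) n (fun s => T j (deviation n s)))).
by rewrite (le_trans (ler_normD _ _))// lerD.
Unshelve. all: by end_near. Qed.

End limit.
End multinomial_clt.

Theorem theorem2p4 (R : realType) (X Y : ptopologicalType)
  (polX : polish R X) (polY : polish R Y)
  (m : nat) (x : 'I_m -> X) (x_inj : injective x)
  (p : 'rV[R]_m) (p_gt0 : forall k, 0 < p 0 k) (p_sum : \sum_k p 0 k = 1)
  (P : probability (borel X) R)
  (P_def : forall A : set (borel X), measurable A ->
    P A = (\sum_k (p 0 k)%:E * \d_(x k : borel X) A)%E)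
  (Q : probability (borel Y) R)
  (c : X * Y -> R) (c_ge0 : forall xy, 0 <= c xy) (c_cont : continuous c)
  (c_lower : exists (a : X -> R) (b : Y -> R),
    [/\ continuous a, P.-integrable [set: borel X] (EFin \o a),
        continuous b, Q.-integrable [set: borel Y] (EFin \o b) &
        forall u v, supp P u -> supp Q v -> a u + b v <= c (u, v)])
  (c_int : forall i, (\int[Q]_y (c (x i, y))%:E < +oo)%E)
  (d d' : measure_display) (W : measurableType d) (W' : measurableType d')
  (Pr : probability W R) (xi : nat -> {RV Pr >-> borel X})
  (xi_iid : iid_sample P xi)
  (Pr' : probability W' R) (G : 'I_m -> {RV Pr' >-> R})
  (G_law : gaussian_vector 0 (Sigma p) G) :
  cvg_in_distribution Pr Pr'
    (fun n w => (Num.sqrt n%:R)%:E *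
       (transport_cost c (empirical xi n w) Q - transport_cost c P Q))%E
    (fun w => ereal_sup [set (\sum_i z 0 i * G i w)%:E | z in Opt c x p P Q]).
Proof.
(* Weights of sum 1 exclude [m = 0]; the successor form makes the index type inhabited. *)
case: m x x_inj p p_gt0 p_sum P_def c_int G G_law => [|m'] x x_inj p p_gt0 p_sum P_def c_int G G_law.
  by move: p_sum; rewrite big_ord0 => /esym/eqP; rewrite oner_eq0.
have p_ge0 i : 0 <= p 0 i by exact: ltW.
have sp : simplex p by [].
pose phi := optimal_value x Q c.
have phi_convex := optimal_value_convex c_ge0 c_cont c_int.
have phi_bound := optimal_value_bound c_ge0 c_cont c_int.
have costE := optimal_costE c_ge0 c_cont c_int.
have OptE z := Opt_subgradient polX x_inj c_ge0 c_cont c_int z sp P_def.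
have [D [Dc Dunif Dsup Dub]] :=
  simplex_directional_derivative p_gt0 p_sum phi_bound phi_convex.
pose F n s : R := Num.sqrt n%:R * (phi (count_weights n s) - phi p).
have mV n : measurable_fun setT (fun w => F n (sample x xi n w)).
  exact: (measurable_sample polX x_inj xi n (F n)).
have mV' : measurable_fun setT (fun w => D (vec G w)) := measurable_vec G Dc.
pose V n : {RV Pr >-> R} := HB.pack (fun w => F n (sample x xi n w))
  (isMeasurableFun.Build _ _ _ _ _ (mV n)).
pose V' : {RV Pr' >-> R} := HB.pack (fun w => D (vec G w))
  (isMeasurableFun.Build _ _ _ _ _ mV').
exists V, V'; split.
- near=> n.
  have n0 : (0 < n)%N by near: n; exact: nbhs_infty_gt.
  apply: filterS (empirical_sample polX x_inj P_def xi_iid) => w /(_ n n0) wE.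
  rewrite (transport_costE Q c wE) (transport_costE Q c P_def).
  by rewrite !costE//; exact: simplex_count_weights (size_sample _ _ _ _).
(* Only on the total-zero event, of probability 1, is the supremum finite; there [Dub] and [Dsup]
   give the two inequalities. *)
- apply: filterS (vec_total_eq0 p_sum G_law) => w w0.
  apply/eqP; rewrite eq_le; apply/andP; split.
    apply/ereal_supP => _ [z /OptE zs <-]; rewrite lee_fin /=.
    by have := Dub z (vec G w) zs w0; rewrite dot_vec.
  have [z zs zE] := Dsup _ w0.
  have -> : V' w = dot z (vec G w) by rewrite zE.
  apply: ereal_sup_ubound; exists z; first exact/OptE.
  by rewrite dot_vec.
- move=> f fc [M fM].
  have gc : continuous (f \o D).
    by move=> h; apply: continuous_comp; [exact: Dc|exact: fc].
  rewrite unlock.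
  under eq_fun do rewrite (expectation_sample polX x_inj P_def xi_iid _ (f \o F _)).
  have -> : (\int[Pr']_w ((f \o V') w)%:E)%E =
      (fine (\int[Pr']_w ((f \o D) (vec G w))%:E)%E)%:E.
    rewrite fineK//; apply: integrable_fin_num => //.
    apply: (bounded_integrable Pr' (measurable_vec G gc)).
    by exists M => w; exact: fM.
  apply: cvg_EFin; first exact: nearW.
  apply: (multinomial_delta p_ge0 p_sum G_law gc (M := M)) => //.
    by move=> y; exact: fM.
    by move=> n s; exact: fM.
  move=> K e e0.
  have [B DB] := continuous_bounded_ball K Dc.
  (* [f] is merely continuous; since [D] maps the ball of radius [K] into [[-B, B]], uniform
     continuity there turns closeness of [F n s] to [D] into closeness of their images. *)
  have [dl dl0 fdl] := uniform_continuous_compact (@segment_compact R (- B) B) fc e0.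
  have dl20 : 0 < dl / 2 by rewrite divr_gt0.
  near=> n => s sn sK.
  have n0 : (0 < n)%N by near: n; exact: nbhs_infty_gt.
  have Dn : forall h : 'rV[R]_m'.+1, `|h| <= K -> \sum_i h 0 i = 0 ->
    `|Num.sqrt n%:R * (phi (p + (Num.sqrt n%:R)^-1 *: h) - phi p) - D h| <= dl / 2.
    by near: n; exact: Dunif.
  rewrite ltW//=; apply: fdl.
    by rewrite /= in_itv/= -ler_norml DB.
  rewrite /F (count_weightsE p n0 sn).
  apply: (le_lt_trans (Dn _ sK (deviation_total p_sum n s))).
  by rewrite ltr_pdivrMr// ltr_pMr// ltr1n.
Unshelve. all: by end_near.
Qed.
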